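(* There is an absolute constant $C$ such that, for every integer $r\ge 2$, there is an $r$-Ramsey complete sequence $A$ of positive integers with $|A\cap[n]|\le Cr\log^{2}n$ for all positive integers $n$. Furthermore, there is an absolute constant $c>0$ such that, for every integer $r\ge 2$, no sequence $A$ of positive integers with $|A\cap[n]|\le cr\log^{2}n$ for all sufficiently large $n$ is $r$-Ramsey complete.
   Context: $[n]=\{1,\dots,n\}$ and $\log$ is the natural logarithm. For a sequence $A$ of positive integers, $\Sigma(A)$ denotes the set of all integers representable as a sum of distinct terms of $A$. A sequence $A$ of positive integers is $r$-Ramsey complete if, whenever $A$ is partitioned into $r$ classes $A_1,\dots,A_r$, every sufficiently large positive integer lies in $\bigcup_{i=1}^r\Sigma(A_i)$. *)

(* Defs.v *)
From Stdlib Require Import Reals List Arith.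
Import ListNotations.
Open Scope R_scope.

(* A sequence A of positive integers is a function a : nat -> nat
   (term number k is a k).  An r-partition of A into classes A_1..A_r is a
   colouring col of the term indices with col k < r (classes may be empty). *)

Definition sum_terms (a : nat -> nat) (s : list nat) : nat :=
  fold_right (fun k acc => (a k + acc)%nat) 0%nat s.

Definition in_Sigma_class (a : nat -> nat) (col : nat -> nat) (i m : nat) : Prop :=
  exists s : list nat, NoDup s /\ Forall (fun k => col k = i) s /\ sum_terms a s = m.

Definition ramsey_complete (r : nat) (a : nat -> nat) : Prop :=
  forall col : nat -> nat, (forall k, (col k < r)%nat) ->
    exists N : nat, forall m : nat, (N <= m)%nat ->
      exists i : nat, (i < r)%nat /\ in_Sigma_class a col i m.

(* |A ∩ [n]| <= B : every finite set of distinct term indices whose terms lie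
   in [n] = {1..n} has at most B elements (terms are positive). *)
Definition count_le (a : nat -> nat) (n : nat) (B : R) : Prop :=
  forall s : list nat, NoDup s -> Forall (fun k => (a k <= n)%nat) s ->
    INR (length s) <= B.

(* Main.v *)
Require Import Defs.
From Stdlib Require Import Reals List Arith.
From Stdlib Require Import Lia Lra Permutation Classical ClassicalEpsilon.
From mathcomp Require all_boot all_algebra zify.
Open Scope R_scope.

(** Lower bound. At a typical scale [y = 2^l], a sequence with at most
    [c r log^2 n] terms up to [n] has small terms (up to [y]) of total [O(c r l y)], and its
    large terms satisfy [sum exp (-a/y) = O(c r l)]. Spread the small terms evenly over half of
    the colours: each of these classes has total below [m ~ l y / 8]. Spread the large terms
    evenly over the other half: by an exponential Markov inequality each of these classes has
    at most [2^(c' l)] subset sums up to [m], with [c' < 1], so most [m] are missed. Earlier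
    choices only concern boundedly many terms, so this can be repeated for infinitely
    many [m].

    Upper bound. For each [L] take [44 r L] random terms [1 + Q z] with [z] in
    [[M, 2M)], [M = 2^L], where [Q] is divisible by all small integers. A most popular
    colour receives [44 L] of them. A union bound shows that, whichever subset [T] of the
    terms is exposed, no set of [z] of density [1/R] determined by [T] contains many of
    the remaining [z], where [R = R(r)] is a constant. So one can always pick a term
    outside a given sparse set. This makes the set [S] of subset sums grow by a factor
    [3/2] up to [|S| ~ M / R] ([2 L] steps), and then by a factor [1 + 1/E] ([o(L)] steps)
    until a set of shifts of density [1/R] moves [S] only slightly. Such shifts generate
    all short shifts in boundedly many steps (no small integer divides them all, thanks to
    [Q]), so [S] is nearly full on a window of length [3N], [N = 2QM]. One more term fills
    an interval of length [2N] completely, and the remaining terms extend it to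
    [[4LN, 20LN)]. These intervals cover all large integers. *)

(** * Blocks of terms that survive every colouring *)

Module Blocks.
Import all_boot all_algebra zify.
Set Implicit Arguments.
Unset Strict Implicit.
Unset Printing Implicit Defensive.
Local Open Scope nat_scope.

(** * Random choices and the union bound *)

Section UnionBound.

Variables (I X Y : finType).

Definition upd (x : {ffun I -> X}) i z : {ffun I -> X} :=
  [ffun j => if j == i then z else x j].

(* Resampling one coordinate: (x, z) |-> (x with x_i := z, x_i) is an involution. *)
Lemma sum_upd (f : {ffun I -> X} -> nat) i :
  \sum_(p : {ffun I -> X} * X) f (upd p.1 i p.2) = #|X| * \sum_x f x.
Proof.
pose sw (p : {ffun I -> X} * X) := (upd p.1 i p.2, p.1 i).
have swK : involutive sw.
  case=> x z; rewrite /sw /=; congr pair; last by rewrite ffunE eqxx.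
  by apply/ffunP => j; rewrite !ffunE; case: eqP => // ->.
rewrite (reindex_inj (can_inj swK)) /=.
have E p : upd (sw p).1 i (sw p).2 = p.1 by rewrite -[in RHS](swK p).
rewrite (eq_bigr (fun p => f p.1)); last by move=> p _; rewrite E.
rewrite -(pair_bigA _ (fun x (z : X) => f x)) /= big_distrr /=.
by apply: eq_bigr => x _; rewrite sum_nat_const.
Qed.

(** Neither [P] nor [F] reads coordinate [i], so resampling that coordinate lands it in [F x] with
    probability at most [1/R]. *)
Lemma card_hit_one (P : pred {ffun I -> X}) (F : {ffun I -> X} -> {set X}) i R :
  0 < #|X| -> (forall x z, P (upd x i z) = P x) ->
  (forall x z, F (upd x i z) = F x) -> (forall x, #|F x| * R <= #|X|) ->
  #|[set x | P x && (x i \in F x)]| * R <= #|[set x | P x]|.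
Proof.
move=> X0 PE FE Fs; rewrite -(leq_pmul2l X0) mulnA.
have -> : #|X| * #|[set x | P x && (x i \in F x)]| = \sum_(x | P x) #|F x|.
  rewrite -sum1dep_card big_mkcond -(sum_upd _ i) /=.
  rewrite -(pair_bigA _ (fun x z => if P (upd x i z) && (upd x i z i \in F (upd x i z))
              then 1 else 0)) /= [RHS]big_mkcond /=.
  apply: eq_bigr => x _; rewrite -sum1_card [X in _ = if _ then X else _]big_mkcond /=.
  case: ifP => Px.
    by apply: eq_bigr => z _; rewrite PE FE Px /upd ffunE eqxx.
  by apply: big1 => z _; rewrite PE Px.
rewrite big_distrl /= -sum1dep_card big_distrr /=.
by apply: leq_sum => x _; rewrite muln1.
Qed.

(** As [F] reads no coordinate in [u], these can be peeled off one at a time, each gaining a factor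
    [R]. *)
Lemma card_hit_all (F : {ffun I -> X} -> {set X}) R (u : seq I) :
  0 < #|X| -> uniq u -> (forall i x z, i \in u -> F (upd x i z) = F x) ->
  (forall x, #|F x| * R <= #|X|) ->
  #|[set x : {ffun I -> X} | all (fun i => x i \in F x) u]| * R ^ size u
    <= #|X| ^ #|I|.
Proof.
move=> X0; elim: u => [|i u IH] /= uu FE Fs.
  by rewrite muln1 -card_ffun max_card.
case/andP: uu => iu uu.
have {}IH := IH uu (fun j x z ju => FE j x z (mem_behead (s := i :: u) ju)) Fs.
apply: leq_trans IH; rewrite expnS mulnA leq_mul2r; apply/orP; right.
pose P (x : {ffun I -> X}) := all (fun j => x j \in F x) u.
have Fi x z : F (upd x i z) = F x by apply: FE; rewrite mem_head.
have := @card_hit_one P F i R X0 _ Fi Fs.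
have -> : [set x : {ffun I -> X} | P x && (x i \in F x)]
  = [set x : {ffun I -> X} | (x i \in F x) && all (fun j => x j \in F x) u].
  by apply/setP => x; rewrite !inE andbC.
apply=> x z; rewrite /P Fi; apply: eq_in_all => j ju.
by rewrite ffunE; case: eqP => // ji; rewrite -ji ju in iu.
Qed.

(** Union bound over triples [(T, U, y)] with [U] of size exactly [h]: there are at most
    [4 ^ #|I| * #|Y|] of them, and each is bad for a proportion at most [1 / R ^ h] of the choices,
    since [F T] reads only coordinates in [T]. *)
Lemma exists_rarely_hit (F : {set I} -> {ffun I -> X} -> Y -> {set X}) R h :
  0 < #|X| ->
  (forall (T : {set I}) y i x z, i \notin T -> F T (upd x i z) y = F T x y) ->
  (forall T x y, #|F T x y| * R <= #|X|) ->
  4 ^ #|I| * #|Y| < R ^ h ->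
  exists x : {ffun I -> X}, forall (T U : {set I}) y,
    [disjoint T & U] -> h <= #|U| -> exists2 i, i \in U & x i \notin F T x y.
Proof.
move=> X0 FE Fs big.
pose bad (q : {set I} * {set I} * Y) := [set x : {ffun I -> X} |
  [&& [disjoint q.1.1 & q.1.2], #|q.1.2| == h
    & [forall i in q.1.2, x i \in F q.1.1 x q.2]]].
have badS q : #|bad q| * R ^ h <= #|X| ^ #|I|.
  case: q => [[T U] y]; rewrite /bad /=.
  case: (boolP [disjoint T & U]) => /= dTU; last first.
    by rewrite [X in X * _]eq_card0 // => x; rewrite !inE.
  case: eqP => /= [Uh|_]; last first.
    by rewrite [X in X * _]eq_card0 // => x; rewrite !inE.
  rewrite -Uh cardE.
  apply: leq_trans (@card_hit_all (fun x => F T x y) R (enum U) X0 (enum_uniq _) _ _);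
    last by move=> x; exact: Fs.
    rewrite leq_mul2r; apply/orP; right; apply: subset_leq_card; apply/subsetP => x.
    rewrite !inE => /forallP H; apply/allP => i; rewrite mem_enum => iU.
    by move: (H i); rewrite iU.
  by move=> i x z; rewrite mem_enum => iU; apply: FE; rewrite (disjointFl dTU).
have lt : #|\bigcup_q bad q| < #|X| ^ #|I|.
  have Rh : 0 < R ^ h by apply: leq_trans big.
  rewrite -(ltn_pmul2r Rh).
  apply: (@leq_ltn_trans (\sum_q (#|bad q| * R ^ h))).
    rewrite -big_distrl leq_mul2r; apply/orP; right.
    elim/big_ind2: _ => [|A a B b Aa Bb|q _] //; first by rewrite cards0.
    by rewrite cardsU; apply: leq_trans (leq_subr _ _) (leq_add Aa Bb).
  apply: (@leq_ltn_trans (\sum_(q : {set I} * {set I} * Y) #|X| ^ #|I|)).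
    by apply: leq_sum.
  rewrite sum_nat_const mulnC ltn_pmul2l ?expn_gt0 ?X0 //.
  rewrite !card_prod -!cardsT -!powersetT !card_powerset !cardsT.
  by rewrite -expnMn.
case: (boolP [exists x, x \notin \bigcup_q bad q]) => [/existsP [x xn]|/existsPn all_bad].
  exists x => T U y dTU hU.
  have [U' U'U U'h] : exists2 U' : {set I}, U' \subset U & #|U'| = h.
    exists [set i in take h (enum U)].
      by apply/subsetP => i; rewrite inE => /mem_take; rewrite mem_enum.
    rewrite cardsE; have /card_uniqP -> := take_uniq h (enum_uniq (mem U)).
    by rewrite size_takel // -cardE.
  have dTU' : [disjoint T & U'] by apply: disjointWr dTU.
  case: (boolP [exists i, (i \in U') && (x i \notin F T x y)]).
    by case/existsP => i /andP [iU' xi]; exists i => //; apply: (subsetP U'U).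
  move/existsPn => H; case/negP: xn; apply/bigcupP.
  exists (T, U', y) => //; rewrite inE /= dTU' U'h eqxx /=.
  by apply/forallP => i; apply/implyP => iU'; move: (H i); rewrite iU' /= negbK.
move: lt; rewrite -card_ffun ltnNge; case/negP; rewrite -cardsT; apply: subset_leq_card.
by apply/subsetP => x _; move: (all_bad x); rewrite negbK.
Qed.

End UnionBound.

(** * Iterated signed sums in a finite abelian group *)

Section Chain.

Import GRing.Theory.

Variables (G : finZmodType) (B : {set G}).

Definition spread (D : {set G}) : {set G} :=
  [set u | [|| u \in D, [exists b in B, (u - b)%R \in D] | [exists b in B, (u + b)%R \in D]]].

(** These are the signed sums of at most [j] members of [B], repetitions allowed. *)
Definition layer j : {set G} := iter j spread [set 0%R].

Lemma spread_sub (D : {set G}) : D \subset spread D.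
Proof. by apply/subsetP => u uD; rewrite inE uD. Qed.

Lemma mem_spreadD (D : {set G}) u b : u \in D -> b \in B -> (u + b)%R \in spread D.
Proof.
move=> uD bB; rewrite inE; apply/or3P; constructor 2; apply/existsP; exists b.
by rewrite bB addrK.
Qed.

Lemma mem_spreadB (D : {set G}) u b : u \in D -> b \in B -> (u - b)%R \in spread D.
Proof.
move=> uD bB; rewrite inE; apply/or3P; constructor 3; apply/existsP; exists b.
by rewrite bB subrK.
Qed.

Lemma mem_layer0 j : 0%R \in layer j.
Proof. by elim: j => [|j IH]; [rewrite inE | apply: (subsetP (spread_sub _))]. Qed.

Lemma layer_fixed j k : j <= k -> spread (layer j) = layer j -> layer k = layer j.
Proof.
move=> /subnK <- E; elim: (k - j) => // m IH.
by rewrite addSn -[layer _.+1]/(spread (layer (m + j))) IH.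
Qed.

(** While the layers grow, a point [z] new at step [3 * i + 2] gives a translate [z + B] that avoids
    [layer (3 * i)] and lies in [layer (3 * i + 3)], so three steps gain [#|B|] elements. *)
Lemma layer_growth i :
  (exists2 j, j < 3 * i & spread (layer j) = layer j) \/ i * #|B| <= #|layer (3 * i)|.
Proof.
elim: i => [|i [[j ji E]|IH]]; first by right.
  by left; exists j => //; lia.
have [E|nE] := eqVneq (layer (3 * i).+2) (layer (3 * i).+1).
  by left; exists (3 * i).+1 => //; lia.
right; have -> : 3 * i.+1 = (3 * i).+3 by lia.
have : (layer (3 * i).+1 \proper layer (3 * i).+2).
  by rewrite properEneq eq_sym nE spread_sub.
case/properP => _ [z zin znin].
have dis : [disjoint layer (3 * i) & [set (z + b)%R | b in B]].
  rewrite disjoint_sym; apply/pred0P => u /=; apply/negP => /andP [/imsetP [b bB ->] zb].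
  by case/negP: znin; rewrite -[z](addrK b); apply: mem_spreadB.
have sub : layer (3 * i) :|: [set (z + b)%R | b in B] \subset layer (3 * i).+3.
  rewrite subUset; apply/andP; split.
    by do 3![apply: subset_trans (spread_sub _) _] => //.
  by apply/subsetP => u /imsetP [b bB ->]; apply: mem_spreadD.
have := subset_leq_card sub; rewrite cardsU (disjoint_setI0 dis) cards0 subn0.
rewrite card_imset; last by move=> b b' /addrI.
by apply: leq_trans; rewrite mulSn addnC leq_add2r.
Qed.

(* Disjoint translates of B can only fit |G| / |B| times. *)
Lemma layer_stable i : #|G| < i * #|B| -> spread (layer (3 * i)) = layer (3 * i).
Proof.
move=> big; case: (layer_growth i) => [[j ji E]|]; last first.
  by move=> h; have := leq_trans (leq_trans big h) (max_card _); rewrite ltnn.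
by have Ek := layer_fixed (ltnW ji) E; rewrite Ek.
Qed.

End Chain.

(** * Dense sets of generators reach every short shift *)

Section Generation.

Import GRing.Theory.

Variables (M Q R Z e : nat) (d : 'Z_Z -> nat) (B : {set 'I_M}).

(** Being [1] modulo [Q] makes each value coprime to [Q], hence free of small divisors once [Q] is
    highly divisible. *)
Definition val_of (z : nat) := (Q * (M + z)).+1.

Hypothesis R0 : 0 < R.
Hypothesis Q0 : 0 < Q.
Hypothesis RM : 2 * R <= M.
Hypothesis QR : forall g, 0 < g < 2 * R -> g %| Q.
Hypothesis BM : M < #|B| * R.
Hypothesis d0 : d 0%R = 0.
Hypothesis dN : forall a : 'Z_Z, d (- a)%R = d a.
Hypothesis dD : forall a b : 'Z_Z, d (a + b)%R <= d a + d b.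
Hypothesis dB : forall z : 'I_M, z \in B -> d (val_of z)%:R%R <= e.

(** Such a [g] is coprime to [Q]. If [g < 2 * R] it also divides [Q], so it is [1]; otherwise [B]
    lies in one residue class modulo [g], which has at most [M / (2 * R) + 1] points, too few for
    the density of [B]. *)
Lemma common_divisor_1 g :
  0 < g -> (forall z : 'I_M, z \in B -> g %| val_of z) -> g = 1.
Proof.
move=> g0 gB.
have [z0 z0B] : exists z0, z0 \in B.
  by apply/set0Pn; apply: contraTneq BM => ->; rewrite cards0.
have cgQ : coprime g Q.
  have : coprime (val_of z0) Q.
    by rewrite /val_of coprime_sym /coprime -addn1 mulnC gcdnMDl gcdn1.
  by apply: coprime_dvdl; apply: gB.
have [gR|gR] := ltnP g (2 * R).
  have gQ : g %| Q by apply: QR; rewrite g0.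
  by move: cgQ; rewrite /coprime; move/gcdn_idPl: gQ => -> /eqP.
have cong (z z' : 'I_M) : z \in B -> z' \in B -> z = z' %[mod g].
  move=> zB z'B.
  wlog le : z z' zB z'B / z <= z'.
    by move=> H; case/orP: (leq_total z z') => l; [apply: H|symmetry; apply: H].
  have : g %| val_of z' - val_of z by rewrite dvdn_sub ?gB.
  have -> : val_of z' - val_of z = Q * (z' - z).
    by rewrite /val_of subSS -mulnBr subnDl.
  by rewrite Gauss_dvdr // -eqn_mod_dvd // => /eqP.
have : #|B| <= M %/ g + 1.
  pose f (z : 'I_M) : 'I_(M %/ g).+1 := inord (z %/ g).
  rewrite addn1 -[X in _ <= X]card_ord; apply: (@leq_card_in _ _ f) => z z' zB z'B.
  have fv (w : 'I_M) : val (f w) = w %/ g.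
    by rewrite /= inordK // ltnS leq_div2r // ltnW.
  move/(congr1 val); rewrite !fv => E; apply: val_inj => /=.
  by rewrite (divn_eq z g) (divn_eq z' g) E (cong z z').
have : M %/ g <= M %/ (2 * R) by apply: leq_div2l; lia.
have := leq_trunc_div M (2 * R).
by move: BM; nia.
Qed.

(** Layers are formed modulo [b0], but [d] lives modulo [Z]. Keeping the positive and negative parts
    [p] and [q] as natural numbers carries the bound on [d] from one modulus to the other. *)
Lemma layer_rep b0 j (u : 'Z_b0) :
  u \in layer [set ((val_of z)%:R : 'Z_b0)%R | z : 'I_M in B] j ->
  exists p q, [/\ p <= j * (2 * Q * M), q <= j * (2 * Q * M),
    u = (p%:R - q%:R)%R & d (p%:R - q%:R)%R <= j * e].
Proof.
elim: j u => [|j IH] u /=.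
  by rewrite inE => /eqP ->; exists 0, 0; rewrite !subrr d0.
have vN (z : 'I_M) : val_of z <= 2 * Q * M.
  by rewrite /val_of; have := ltn_ord z; nia.
rewrite inE => /or3P [uD|/existsP [b /andP [/imsetP [z zB ->] uD]]
  |/existsP [b /andP [/imsetP [z zB ->] uD]]].
- have [p [q [ph qh -> dh]]] := IH _ uD.
  by exists p, q; rewrite mulSn; split=> //; lia.
- have [p [q [ph qh E dh]]] := IH _ uD.
  exists (p + val_of z), q; have := vN z; split; try lia.
    by rewrite natrD addrAC -E subrK.
  rewrite natrD addrAC; apply: leq_trans (dD _ _) _.
  by rewrite mulSn addnC leq_add // dB.
- have [p [q [ph qh E dh]]] := IH _ uD.
  exists p, (q + val_of z); have := vN z; split; try lia.
    by rewrite natrD opprD addrA -E addrK.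
  rewrite natrD opprD addrA; apply: leq_trans (dD _ _) _.
  by rewrite dN mulSn addnC leq_add // dB.
Qed.

Lemma d_mul (a : 'Z_Z) m : d (a *+ m)%R <= m * d a.
Proof.
elim: m => [|m IH]; first by rewrite mulr0n d0.
by rewrite mulrS mulSn; apply: leq_trans (dD _ _) _; rewrite leq_add2l.
Qed.

(** Work modulo one generator [b0]. There the layers stabilise after [6 * Q * R] steps at a set
    invariant under all generators; these have no common divisor, so the set is everything.
    Returning to integers costs boundedly many multiples of [b0], itself a generator. *)
Lemma generation c : c <= 6 * Q * M -> d c%:R%R <= (18 * Q * R + 6) * e.
Proof.
move=> cN.
have [z0 z0B] : exists z0, z0 \in B.
  by apply/set0Pn; apply: contraTneq BM => ->; rewrite cards0.
pose b0 := val_of z0.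
have b0M : Q * M < b0 <= 2 * Q * M.
  by rewrite /b0 /val_of; have := ltn_ord z0; nia.
have b1 : 1 < b0 by nia.
pose Bb := [set ((val_of z)%:R : 'Z_b0)%R | z : 'I_M in B].
have cB : #|Bb| = #|B|.
  apply: card_in_imset => z z' zB z'B E; apply: val_inj => /=.
  move/(congr1 val): E; rewrite /= !val_Zp_nat // => {zB z'B}.
  wlog le : z z' / z <= z'.
    by move=> H; case/orP: (leq_total z z') => l E; [apply: H|symmetry; apply: H].
  move=> /esym /eqP; rewrite eqn_mod_dvd; last by rewrite ltnS leq_mul2l leq_add2l le orbT.
  have -> : val_of z' - val_of z = Q * (z' - z) by rewrite subSS -mulnBr subnDl.
  move/dvdn_leq => H; have := ltn_ord z'; case: (posnP (z' - z)) => [|pos] zM; first lia.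
  have : b0 <= Q * (z' - z) by apply: H; rewrite muln_gt0 Q0.
  have : Q * (z' - z) <= Q * M by rewrite leq_mul2l; lia.
  by lia.
have st : spread Bb (layer Bb (3 * (2 * Q * R))) = layer Bb (3 * (2 * Q * R)).
  apply: layer_stable; rewrite cB card_ord Zp_cast //.
  apply: (@leq_ltn_trans (2 * Q * M)); first by case/andP: b0M.
  by rewrite -[2 * Q * R * _]mulnA ltn_pmul2l ?muln_gt0 ?Q0 // mulnC.
set D := layer _ _ in st.
have DB u z : z \in B -> ((u + (val_of z)%:R)%R \in D) = (u \in D).
  move=> zB; have vB : (val_of z)%:R%R \in Bb by apply: imset_f.
  apply/idP/idP => h; rewrite -st; last exact: mem_spreadD.
  by rewrite -[u](addrK (val_of z)%:R%R); apply: mem_spreadB.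
(* These are the periods of [D]. By Euclidean division the least positive one divides every
   generator, hence equals [1]. *)
pose stab n := [forall u : 'Z_b0, ((u + n%:R)%R \in D) == (u \in D)].
have stabP n : reflect (forall u : 'Z_b0, ((u + n%:R)%R \in D) = (u \in D)) (stab n).
  by apply: (iffP forallP) => H u; apply/eqP.
have ex : exists g, (0 < g) && stab g.
  by exists b0; rewrite ltnW //=; apply/stabP => u; rewrite pchar_Zp // addr0.
have stabD m n : stab m -> stab n -> stab (m + n).
  by move=> /stabP Hm /stabP Hn; apply/stabP => u; rewrite natrD addrA Hn Hm.
have stabM m n : stab m -> stab (n * m).
  by move=> Hm; elim: n => [|n IH]; [apply/stabP => u; rewrite addr0|rewrite mulSn stabD].
have stabB m n : stab (m + n) -> stab m -> stab n.
  move=> /stabP Hmn /stabP Hm; apply/stabP => u.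
  by rewrite -(Hm (u + n%:R)%R) -addrA -natrD addnC Hmn.
case: (ex_minnP ex) => g /andP [g0 Hg] gmin.
have g1 : g = 1.
  apply: common_divisor_1 => // z zB.
  have Hz : stab (val_of z) by apply/stabP => u; apply: DB.
  rewrite /dvdn eqn0Ngt; apply/negP => m0.
  have : stab (val_of z %% g).
    by apply: (stabB (val_of z %/ g * g)); rewrite -?divn_eq ?stabM.
  by move=> Hm; have := gmin _ (introT andP (conj m0 Hm)); rewrite leqNgt ltn_mod g0.
have cD : (c%:R : 'Z_b0)%R \in D.
  rewrite -[c]muln1 -g1; have /stabP H := stabM _ c Hg.
  rewrite -[X in X \in _]add0r H; apply: mem_layer0.
have [p [q [ph qh E dh]]] := layer_rep cD.
have cq : c + q = p %[mod b0].
  have : ((c + q)%:R = p%:R :> 'Z_b0)%R by rewrite natrD E subrK.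
  by move/(congr1 val); rewrite /= !val_Zp_nat.
have db : d (b0%:R)%R <= e by apply: dB.
have [le|lt] := leqP p (c + q).
- have : b0 %| c + q - p by rewrite -eqn_mod_dvd // cq.
  case/dvdnP => m mE.
  have -> : (c%:R = (p%:R - q%:R) + b0%:R *+ m :> 'Z_Z)%R.
    rewrite -mulrnA addrAC -natrD mulnC -mE subnKC //.
    by rewrite natrD addrK.
  apply: leq_trans (dD _ _) _; have := d_mul (b0%:R)%R m.
  (* Here [c + q] is at most [6 * Q * M + 6 * Q * R * (2 * Q * M)], while [b0 > Q * M]. *)
  have mb : m <= 12 * Q * R + 6.
    rewrite -(leq_pmul2r (ltnW b1)) -mE.
    have [b0l _] := andP b0M; nia.
  move=> dm; apply: (@leq_trans (3 * (2 * Q * R) * e + m * e)).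
    by rewrite leq_add // (leq_trans dm) // leq_mul2l db orbT.
  by rewrite -mulnDl leq_mul2r; apply/orP; right; nia.
- have : b0 %| p - (c + q) by rewrite -eqn_mod_dvd 1?ltnW // cq.
  case/dvdnP => m mE.
  have -> : (c%:R = (p%:R - q%:R) - b0%:R *+ m :> 'Z_Z)%R.
    apply: (addIr (b0%:R *+ m)%R); rewrite subrK -mulrnA mulnC -mE.
    by apply: (addIr q%:R%R); rewrite subrK addrAC -!natrD subnKC // ltnW.
  apply: leq_trans (dD _ _) _; rewrite dN; have := d_mul (b0%:R)%R m.
  have mb : m <= 12 * Q * R + 6.
    rewrite -(leq_pmul2r (ltnW b1)) -mE.
    have [b0l _] := andP b0M; nia.
  move=> dm; apply: (@leq_trans (3 * (2 * Q * R) * e + m * e)).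
    by rewrite leq_add // (leq_trans dm) // leq_mul2l db orbT.
  by rewrite -mulnDl leq_mul2r; apply/orP; right; nia.
Qed.

End Generation.

(** * Subset sums modulo [Z] and their displacement under shifts *)

Section SubsetSums.

Import GRing.Theory.

Variables (n Z : nat).

Definition sums (w : 'I_n -> nat) (T : {set 'I_n}) : {set 'Z_Z} :=
  [set ((\sum_(i in U) w i)%:R : 'Z_Z)%R | U : {set 'I_n} in powerset T].

(** As a function of [c] this is symmetric and subadditive, so it can serve as the length [d] of the
    generation argument. *)
Definition defect (S : {set 'Z_Z}) (c : 'Z_Z) := #|[set s in S | (s + c)%R \notin S]|.

Lemma sums_sub w (T T' : {set 'I_n}) : T \subset T' -> sums w T \subset sums w T'.
Proof. by move=> TT'; apply: imsetS; rewrite powersetS. Qed.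

Lemma mem_sums0 w T : 0%R \in sums w T.
Proof. by apply/imsetP; exists set0; rewrite ?powersetE ?sub0set // big_set0. Qed.

Lemma sums_gt0 w T : 0 < #|sums w T|.
Proof. by apply/card_gt0P; exists 0%R; exact: mem_sums0. Qed.

Lemma eq_sums w w' (T : {set 'I_n}) :
  (forall i, i \in T -> w i = w' i) -> sums w T = sums w' T.
Proof.
move=> E; apply: eq_in_imset => U; rewrite powersetE => /subsetP UT.
by rewrite (eq_bigr w') // => i iU; apply: E; apply: UT.
Qed.

Lemma mem_sumsU1 w i (T : {set 'I_n}) s :
  i \notin T -> s \in sums w T -> (s + (w i)%:R)%R \in sums w (i |: T).
Proof.
move=> iT /imsetP [U]; rewrite powersetE => UT ->; apply/imsetP; exists (i |: U).
  by rewrite powersetE setUS.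
rewrite big_setU1 /=; last by apply: contra iT; apply: (subsetP UT).
by rewrite natrD addrC.
Qed.

Lemma card_sumsU1 w i (T : {set 'I_n}) : i \notin T ->
  #|sums w T| + defect (sums w T) (w i)%:R%R <= #|sums w (i |: T)|.
Proof.
move=> iT; set S := sums w T.
pose D := [set s in S | (s + (w i)%:R)%R \notin S].
have dis : [disjoint S & [set (s + (w i)%:R)%R | s in D]].
  rewrite disjoint_sym; apply/pred0P => u /=; apply/negP => /andP [/imsetP [s]].
  by rewrite inE => /andP [_ /negP h] ->.
have sub : S :|: [set (s + (w i)%:R)%R | s in D] \subset sums w (i |: T).
  rewrite subUset sums_sub ?subsetUr //=; apply/subsetP => u /imsetP [s].
  by rewrite inE => /andP [sS _] ->; apply: mem_sumsU1.
have := subset_leq_card sub; rewrite cardsU (disjoint_setI0 dis) cards0 subn0.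
by rewrite (card_imset (mem D) (addIr ((w i)%:R)%R)).
Qed.

Variable S : {set 'Z_Z}.

Lemma defect0 : defect S 0%R = 0.
Proof.
by apply/eqP; rewrite cards_eq0; apply/eqP/setP => s; rewrite !inE addr0 andbN.
Qed.

Lemma defect_keep c : defect S c + #|[set s in S | (s + c)%R \in S]| = #|S|.
Proof.
rewrite -(cardsID [set s | (s + c)%R \in S] S) addnC; congr (_ + _); apply: eq_card => s;
  by rewrite !inE // andbC.
Qed.

Lemma defectN c : defect S (- c)%R = defect S c.
Proof.
have E := etrans (defect_keep (- c)%R) (esym (defect_keep c)).
suff Ek : #|[set s in S | (s - c)%R \in S]| = #|[set s in S | (s + c)%R \in S]|.
  by apply/eqP; move: E => /eqP; rewrite Ek eqn_add2r.
rewrite -(card_imset (mem [set s in S | (s + c)%R \in S]) (addIr c)).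
apply: eq_card => s; rewrite !inE; apply/andP/imsetP => [[sS scS]|[u]].
  by exists (s - c)%R; rewrite ?subrK // inE subrK scS.
by rewrite inE => /andP [uS ucS] ->; rewrite addrK.
Qed.

(** If [s + a + b] is outside [S] while [s + a] is inside, then [s + a] is a point of [S] that [b]
    moves out. *)
Lemma defectD a b : defect S (a + b)%R <= defect S a + defect S b.
Proof.
rewrite [defect S b]/defect -(card_imset (mem [set s in S | (s + b)%R \notin S]) (addIr (- a)%R)).
apply: (@leq_trans #|[set s in S | (s + a)%R \notin S]
   :|: [set (s - a)%R | s in [set s in S | (s + b)%R \notin S]]|).
  apply: subset_leq_card; apply/subsetP => s; rewrite !inE => /andP [sS h].
  rewrite sS; case: (boolP ((s + a)%R \in S)) => //= saS.
  by apply/imsetP; exists (s + a)%R; rewrite ?addrK // inE saS -addrA.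
by rewrite cardsU leq_subr.
Qed.

End SubsetSums.

(** * From well-chosen terms to a full interval of sums *)

Section Covering.

Import GRing.Theory.

Variables (M Q R E L n : nat).

Let N := 2 * Q * M.
(** Neither a sum of [4 * L] terms, each at most [N], nor a target below [(3 * L + 3) * N] wraps
    around modulo [Z]. *)
Let Z := ((4 * L + 3) * N).+1.
Let v (z : nat) := val_of M Q z.

Hypothesis R0 : 0 < R.
Hypothesis Q0 : 0 < Q.
Hypothesis L0 : 0 < L.
Hypothesis RM : 2 * R <= M.
Hypothesis QR : forall g, 0 < g < 2 * R -> g %| Q.
Hypothesis EE : E = 6 * Q * (18 * Q * R + 6) * R.
Hypothesis ML : M <= 2 ^ L.
Hypothesis EL : E ^ L * (2 * R * (2 * (4 * L + 3) * Q + 1)) < E.+1 ^ L.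

(** For these [z], adjoining the translate of [S] by [v z] enlarges [S] by less than a proportion
    [1/k]. *)
Definition slow (k : nat) (S : {set 'Z_Z}) : {set 'I_M} :=
  [set z : 'I_M | k * defect S (v z)%:R%R < #|S|].

Definition misses (S : {set 'Z_Z}) (g : 'Z_Z) : {set 'I_M} :=
  [set z : 'I_M | (g - (v z)%:R)%R \notin S].

(** With [None], terms giving slow growth are blocked: rate [3/2] while [S] is small, rate [1 + 1/E]
    afterwards. With [Some g], terms that fail to complete [g] are blocked. The guards keep the
    density at most [1/R] for every nonempty [S]. *)
Definition avoid (S : {set 'Z_Z}) (y : option 'Z_Z) : {set 'I_M} :=
  match y with
  | None => if 2 * #|S| * R <= M then slow 2 S
            else if #|slow E S| * R <= M then slow E S else set0
  | Some g => if #|misses S g| * R <= M then misses S g else set0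
  end.

Lemma v_bounds (z : 'I_M) : Q * M <= v z <= N.
Proof. by rewrite /v /val_of /N; move: Q0 (ltn_ord z); clear; nia. Qed.

Lemma Z_gt1 : 1 < Z.
Proof. by rewrite /Z /N ltnS !muln_gt0 Q0 /= addn_gt0 orbT; move: R0 RM; clear; lia. Qed.

Lemma natZ_inj a b : a < Z -> b < Z -> (a%:R = b%:R :> 'Z_Z)%R -> a = b.
Proof.
by move=> aZ bZ /(congr1 val); rewrite /= !val_Zp_nat ?Z_gt1 // !modn_small.
Qed.

Lemma v_inj (z z' : 'I_M) : ((v z)%:R = (v z')%:R :> 'Z_Z)%R -> z = z'.
Proof.
have vZ (u : 'I_M) : v u < Z.
  have /andP [_ h] := v_bounds u; rewrite /Z ltnS; apply: leq_trans h _.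
  by rewrite leq_pmull ?addn_gt0 ?orbT.
move/natZ_inj => /(_ (vZ _) (vZ _)) [] /eqP.
by rewrite eqn_mul2l eqn_add2l eqn0Ngt Q0 /= => /eqP /val_inj.
Qed.

(** Count pairs [(s, z)] with [s] and [s + v z] both in [S]: there are at most [#|S| ^ 2], and each
    slow [z] accounts for more than [#|S| / 2] of them. *)
Lemma slow2_card (S : {set 'Z_Z}) : 0 < #|S| -> #|slow 2 S| <= 2 * #|S|.
Proof.
move=> S0; rewrite -(leq_pmul2r S0).
have H : \sum_(z : 'I_M) #|[set s in S | (s + (v z)%:R)%R \in S]| <= #|S| * #|S|.
  rewrite (eq_bigr (fun z : 'I_M => \sum_(s in S) ((s + (v z)%:R)%R \in S))); last first.
    move=> z _; rewrite -sum1dep_card big_mkcondr /=.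
    by apply: eq_bigr => s _; case: ifP.
  rewrite exchange_big /= -sum_nat_const; apply: leq_sum => s _.
  rewrite (eq_bigr (fun z : 'I_M => if (s + (v z)%:R)%R \in S then 1 else 0)); last first.
    by move=> z _; case: ifP.
  rewrite -big_mkcond sum1dep_card.
  rewrite -(@card_in_imset _ _ (fun z : 'I_M => (s + (v z)%:R)%R)); last first.
    by move=> z z' _ _ /addrI; apply: v_inj.
  apply: subset_leq_card; apply/subsetP => u /imsetP [z]; rewrite inE => h -> //.
apply: (@leq_trans (\sum_(z in slow 2 S) 2 * #|[set s in S | (s + (v z)%:R)%R \in S]|)).
  rewrite -sum_nat_const; apply: leq_sum => z; rewrite inE.
  by have := defect_keep S (v z)%:R%R; clear; lia.
rewrite -mulnA -big_distrr /= leq_mul2l /=; apply: leq_trans H.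
by rewrite [X in _ <= X](bigID (mem (slow 2 S))) /= leq_addr.
Qed.

Lemma avoid_card (S : {set 'Z_Z}) y : 0 < #|S| -> #|avoid S y| * R <= M.
Proof.
move=> S0; case: y => [g|] /=; first by case: ifP => //; rewrite cards0.
case: ifP => [h|_]; last by case: ifP => //; rewrite cards0.
by apply: leq_trans h; rewrite leq_mul2r slow2_card ?orbT.
Qed.

(* A set that a positive proportion of the generators moves only slightly is nearly invariant under all
   small shifts, so some window of length 3N is almost full. *)
Lemma full_window (S : {set 'Z_Z}) : 0 < #|S| -> M < #|slow E S| * R ->
  exists2 t, t \in S & #|[set c : 'I_(3 * N) | (t + c%:R)%R \notin S]| * R <= M.
Proof.
move=> S0 sl.
have E0 : 0 < E by rewrite EE !muln_gt0 Q0 R0 addn_gt0 orbT.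
(* Each slow [z] has defect at most [#|S| / E], which is the value of [e] here. *)
have gen c : c <= 6 * Q * M -> defect S c%:R%R <= (18 * Q * R + 6) * (#|S| %/ E).
  apply: (generation R0 Q0 RM QR sl (defect0 S) (defectN S) (defectD S)) => z.
  by rewrite inE mulnC => h; rewrite leq_divRL // ltnW.
case: (boolP [exists t in S, #|[set c : 'I_(3 * N) | (t + c%:R)%R \notin S]| * R <= M]).
  by case/existsP => t /andP [tS h]; exists t.
move/existsPn => H; exfalso.
have sumE : \sum_(t in S) #|[set c : 'I_(3 * N) | (t + c%:R)%R \notin S]|
    = \sum_(c < 3 * N) defect S c%:R%R.
  rewrite (eq_bigr (fun t => \sum_(c < 3 * N) ((t + c%:R)%R \notin S))); last first.
    by move=> t _; rewrite -sum1dep_card big_mkcond; apply: eq_bigr => c _; case: ifP.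
  rewrite exchange_big /=; apply: eq_bigr => c _.
  rewrite /defect -sum1dep_card big_mkcondr /=.
  by apply: eq_bigr => s _; case: ifP.
have lo : #|S| * M < (\sum_(t in S) #|[set c : 'I_(3 * N) | (t + c%:R)%R \notin S]|) * R.
  rewrite big_distrl /=.
  apply: (@leq_trans (\sum_(t in S) M.+1)).
    by rewrite sum_nat_const ltn_pmul2l.
  by apply: leq_sum => t tS; move: (H t); rewrite tS /= -ltnNge.
have hi : \sum_(c < 3 * N) defect S c%:R%R
    <= 3 * N * ((18 * Q * R + 6) * (#|S| %/ E)).
  rewrite -[X in _ <= X * _](card_ord (3 * N)) -sum_nat_const; apply: leq_sum => c _.
  by apply: gen; have := ltn_ord c; rewrite /N; lia.
move: lo; rewrite sumE ltnNge => /negP; apply.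
apply: (@leq_trans (3 * N * ((18 * Q * R + 6) * (#|S| %/ E)) * R)).
  by rewrite leq_mul2r hi orbT.
(* The value of [E] is chosen exactly for [3 * N * (18 * Q * R + 6) * R = M * E]. *)
have -> : 3 * N * ((18 * Q * R + 6) * (#|S| %/ E)) * R = M * (#|S| %/ E * E).
  by rewrite EE /N; lia.
by rewrite mulnC leq_mul2r leq_trunc_div orbT.
Qed.

Variable x : {ffun 'I_n -> 'I_M}.

Let w (i : 'I_n) := v (x i).

Hypothesis xgood : forall (T U : {set 'I_n}) y, [disjoint T & U] -> L <= #|U| ->
  exists2 i, i \in U & x i \notin avoid (sums Z w T) y.

Variable W : {set 'I_n}.
Hypothesis W4 : #|W| = 4 * L.

(** At least [L] indices of [W] lie outside [T], so not all of them can fall in the set to avoid. *)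
Lemma pick_good (T : {set 'I_n}) y : T \subset W -> #|T| <= 3 * L ->
  exists i, [/\ i \in W, i \notin T & x i \notin avoid (sums Z w T) y].
Proof.
move=> TW T3.
have [||i] := @xgood T (W :\: T) y.
- by rewrite disjoint_sym disjoints_subset; apply/subsetP => i; rewrite !inE => /andP [].
- have := cardsID T W; rewrite (setIidPr TW); lia.
by rewrite inE => /andP [iT iW] h; exists i.
Qed.

Lemma grow_fast j : j <= 2 * L -> exists T : {set 'I_n}, [/\ T \subset W, #|T| <= j &
  M < 2 * #|sums Z w T| * R \/ 3 ^ j <= #|sums Z w T| * 2 ^ j].
Proof.
elim: j => [|j IH] jL.
  by exists set0; rewrite sub0set cards0; split=> //; right; rewrite muln1 sums_gt0.
have [T [TW Tj H]] := IH (ltnW jL).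
have [big|small] := ltnP M (2 * #|sums Z w T| * R).
  by exists T; split=> //; [lia|left].
case: H => [|H]; first by rewrite ltnNge small.
have [|i [iW iT]] := @pick_good T None TW; first by lia.
rewrite /= small inE -leqNgt => h; exists (i |: T); split.
- by rewrite subUset sub1set iW.
- by rewrite cardsU1 iT; lia.
right; have g := card_sumsU1 Z w iT; rewrite -[v (x i)]/(w i) in h.
rewrite !expnS; apply: (@leq_trans (3 * (#|sums Z w T| * 2 ^ j))); first by rewrite leq_mul2l.
rewrite !mulnA leq_mul2r; apply/orP; right.
move: h g; set d := defect _ _; set a := #|sums Z w T|; set a' := #|sums Z w _|.
by clear; lia.
Qed.

Lemma grow_slow j : j <= L -> exists T : {set 'I_n}, [/\ T \subset W, #|T| <= 2 * L + j &
  M < #|slow E (sums Z w T)| * R \/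
  (M < 2 * #|sums Z w T| * R /\ E.+1 ^ j * M <= 2 * R * #|sums Z w T| * E ^ j)].
Proof.
elim: j => [|j IH] jL.
  have [T [TW T2 H]] := grow_fast (leqnn _).
  exists T; rewrite addn0; split=> //; right.
  (* After [2 * L] fast steps the growth [(9/4) ^ L] exceeds [2 ^ L], hence [M]. *)
  suff big : M < 2 * #|sums Z w T| * R by split=> //; lia.
  case: H => // H; rewrite ltnNge; apply/negP => small.
  have : #|sums Z w T| <= 2 ^ L by nia.
  move: H; rewrite !expnM => H S2.
  have : 9 ^ L <= 8 ^ L.
    apply: leq_trans H _; apply: (@leq_trans (2 ^ L * 4 ^ L)); last by rewrite -expnMn.
    by rewrite leq_mul2r S2 orbT.
  by rewrite leq_exp2r.
have [T [TW Tj H]] := IH (ltnW jL).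
have [big|small] := ltnP M (#|slow E (sums Z w T)| * R).
  by exists T; split=> //; [lia|left].
case: H => [|[H1 H2]]; first by rewrite ltnNge small.
have [|i [iW iT]] := @pick_good T None TW; first by lia.
rewrite /= leqNgt H1 /= small inE -leqNgt => h; exists (i |: T); split.
- by rewrite subUset sub1set iW.
- by rewrite cardsU1 iT; lia.
right; have g := card_sumsU1 Z w iT; rewrite -[v (x i)]/(w i) in h.
have {}g : E.+1 * #|sums Z w T| <= E * #|sums Z w (i |: T)|.
  apply: (@leq_trans (E * (#|sums Z w T| + defect (sums Z w T) (w i)%:R%R))).
    by rewrite mulSn addnC mulnDr leq_add2l.
  by rewrite leq_mul2l g orbT.
split.
  apply: leq_trans H1 _; rewrite leq_mul2r leq_mul2l /=; apply/orP; right.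
  by apply: subset_leq_card; apply: sums_sub; apply: subsetUr.
rewrite !expnS -mulnA.
apply: (@leq_trans (E.+1 * (2 * R * #|sums Z w T| * E ^ j))); first by rewrite leq_mul2l H2 orbT.
have mulE a b c : a * (2 * R * b * c) = 2 * R * c * (a * b) by clear; lia.
have mulE' a b c : 2 * R * b * (a * c) = 2 * R * c * (a * b) by clear; lia.
by rewrite (mulE' E) mulE leq_mul2l g orbT.
Qed.

(** By [EL], growth by [(1 + 1/E) ^ L] would exceed the [Z] available residues, so only the first
    alternative of [grow_slow] is possible. *)
Lemma sums_window : exists (T : {set 'I_n}) t, [/\ T \subset W, #|T| <= 3 * L,
  t \in sums Z w T & #|[set c : 'I_(3 * N) | (t + c%:R)%R \notin sums Z w T]| * R <= M].
Proof.
have [T [TW T3 H]] := grow_slow (leqnn _).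
have T3' : #|T| <= 3 * L by lia.
case: H => [H|[_ H]].
  by have [t tS h] := full_window (sums_gt0 _ _ _) H; exists T, t.
exfalso; have : #|sums Z w T| <= Z.
  by apply: leq_trans (max_card _) _; rewrite card_ord Zp_cast ?Z_gt1.
rewrite /Z /N => SZ; move: EL; rewrite ltnNge => /negP; apply.
have M0 : 0 < M by move: R0 RM; clear; lia.
rewrite -(leq_pmul2r M0); apply: leq_trans H _.
have SZ' : #|sums Z w T| <= (2 * (4 * L + 3) * Q + 1) * M.
  by apply: leq_trans SZ _; move: M0; clear; nia.
have -> : E ^ L * (2 * R * (2 * (4 * L + 3) * Q + 1)) * M
  = 2 * R * ((2 * (4 * L + 3) * Q + 1) * M) * E ^ L by clear; lia.
by rewrite leq_mul2r leq_mul2l SZ' !orbT.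
Qed.

Lemma sum_w_le (U : {set 'I_n}) : \sum_(i in U) w i <= #|U| * N.
Proof.
by rewrite -sum_nat_const; apply: leq_sum => i _; case/andP: (v_bounds (x i)).
Qed.

Lemma interval_sums : exists2 tau, tau <= 3 * L * N &
  forall m, tau + N <= m < tau + 3 * N ->
    exists2 U : {set 'I_n}, U \subset W & \sum_(i in U) w i = m.
Proof.
have [T [t [TW T3 tS tw]]] := sums_window.
have /imsetP [U0] := tS; rewrite powersetE => U0T tE.
exists (\sum_(i in U0) w i).
  apply: leq_trans (sum_w_le _) _; rewrite leq_mul2r; apply/orP; right.
  by apply: leq_trans (subset_leq_card U0T) T3.
set tau := \sum_(i in U0) w i in tE *.
have tauN : tau <= 3 * L * N.
  apply: leq_trans (sum_w_le _) _; rewrite leq_mul2r; apply/orP; right.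
  by apply: leq_trans (subset_leq_card U0T) T3.
move=> m mb.
(* As [v z <= N], each [m - v z] lies in the window starting at [tau], so the [z] that fail to
   complete [m] are as rare as the gaps of that window. *)
have mc : #|misses (sums Z w T) m%:R%R| * R <= M.
  apply: leq_trans tw; rewrite leq_mul2r; apply/orP; right.
  have cb (z : 'I_M) : m - tau - v z < 3 * N.
    by move: mb; have := v_bounds z; move: (v z) => b; clear; lia.
  rewrite -(@card_in_imset _ _ (fun z : 'I_M => Ordinal (cb z))); last first.
    move=> z z' _ _ [] h; apply: v_inj; congr (_%:R)%R.
    have := v_bounds z; have := v_bounds z'; move: mb h.
    by move: (v z) (v z') => b b'; clear; lia.
  apply: subset_leq_card; apply/subsetP => c /imsetP [z zm ->]; move: zm; rewrite !inE /= => h.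
  apply: contra h; rewrite tE -natrD.
  have -> : tau + (m - tau - v z) = m - v z.
    by move: mb; have := v_bounds z; move: (v z) => b; clear; lia.
  rewrite natrB //.
  by move: mb; have := v_bounds z; move: (v z) => b; clear; lia.
have [i [iW iT]] := pick_good (Some m%:R%R) TW T3.
rewrite /= mc inE negbK => h.
have : m%:R%R \in sums Z w W.
  apply: (subsetP (_ : sums Z w (i |: T) \subset _)).
    by apply: sums_sub; rewrite subUset sub1set iW.
  by rewrite -[m%:R%R](subrK (v (x i))%:R%R); apply: mem_sumsU1.
case/imsetP => U; rewrite powersetE => UW mU; exists U => //.
symmetry; apply: natZ_inj mU.
  by rewrite /Z; move: mb tauN; clear; nia.
rewrite /Z ltnS; apply: leq_trans (sum_w_le _) _; rewrite leq_mul2r; apply/orP; right.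
by have := subset_leq_card UW; rewrite W4; lia.
Qed.

(** Each new term is at most [N], hence at most the length of the interval, so the interval and its
    shift by that term leave no gap. *)
Lemma extend_sums (V : {set 'I_n}) lo len : [disjoint W & V] -> N <= len ->
  (forall m, lo <= m < lo + len ->
    exists2 U : {set 'I_n}, U \subset W & \sum_(i in U) w i = m) ->
  forall m, lo <= m < lo + len + \sum_(i in V) w i ->
    exists2 U : {set 'I_n}, U \subset W :|: V & \sum_(i in U) w i = m.
Proof.
move=> + Nlen H; move: {-1}(#|V|) (leqnn #|V|) => k; elim: k V => [|k IH] V.
  rewrite leqn0 cards_eq0 => /eqP -> _ m; rewrite big_set0 addn0 setU0; exact: H.
have [-> _ _ m|[i iV]] := set_0Vmem V.
  by rewrite big_set0 addn0 setU0; exact: H.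
rewrite (cardsD1 i V) iV add1n ltnS => Vk dWV m mb.
have sub : V :\ i \subset V by apply: subsetDl.
have dWV' : [disjoint W & V :\ i] by apply: disjointWr dWV.
have {}IH := IH _ Vk dWV'.
rewrite (big_setD1 i iV) /= in mb.
set s := \sum_(j in V :\ i) w j in mb IH.
have wN : w i <= N by case/andP: (v_bounds (x i)).
have [mlt|mge] := ltnP m (lo + len + s).
  have [|U UW Um] := IH m; first by case/andP: mb => -> _.
  by exists U => //; apply: subset_trans UW _; rewrite setUS.
have [|U UW Um] := IH (m - w i).
  by move: mb mge wN Nlen; clear; rewrite !addnA; move: (w i) s N => b c d; lia.
have iU : i \notin U.
  apply/negP => /(subsetP UW); rewrite !inE eqxx /= orbF => iW.
  by have := disjointFr dWV iW; rewrite iV.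
exists (i |: U).
  rewrite subUset sub1set !inE iV orbT /=; apply: subset_trans UW _; rewrite setUS //.
by rewrite big_setU1 //= Um; move: mge wN Nlen; clear; lia.
Qed.

End Covering.

(** * Choice of constants and existence of blocks *)

Lemma linear_lt_exp_ratio E a : 0 < E ->
  exists L0, forall L, L0 <= L -> E ^ L * (a * L.+1) < E.+1 ^ L.
Proof.
move=> E0; exists (8 * a * E ^ 2 + 4) => L LL.
(* This is Bernoulli's inequality [(1 + 1/E) ^ k >= 1 + k/E]. Squared at [k = L./2] it gives
   quadratic growth in [L], which beats the linear factor. *)
have bern k : (E + k) * E ^ k <= E * E.+1 ^ k.
  elim: k => [|k IH]; first by rewrite addn0.
  rewrite !expnS mulnCA (mulnCA E E.+1).
  apply: (@leq_trans (E.+1 * ((E + k) * E ^ k))); last by rewrite leq_mul2l.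
  by rewrite !mulnA leq_mul2r; apply/orP; right; nia.
have sq : L./2 ^ 2 * E ^ L <= E ^ 2 * E.+1 ^ L.
  have sq2 k : k ^ 2 * E ^ k.*2 <= E ^ 2 * E.+1 ^ k.*2.
    rewrite -muln2 !expnM -!expnMn leq_exp2r //.
    by apply: leq_trans (bern k); rewrite leq_mul2r leq_addl orbT.
  have EL : odd L + L./2.*2 = L := odd_double_half L.
  rewrite -{2 3}EL !expnD mulnCA [X in _ <= X]mulnCA.
  by rewrite leq_mul //; case: (odd L); rewrite ?expn0 ?expn1.
have kL : 4 * a * E ^ 2 < L./2 by lia.
have Ep : 0 < E ^ 2 by rewrite expn_gt0 E0.
have EL : 0 < E ^ L by rewrite expn_gt0 E0.
rewrite -(ltn_pmul2l Ep); apply: leq_trans sq.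
rewrite mulnCA (mulnC _ (E ^ L)) ltn_pmul2l //.
have : L.+1 <= 4 * L./2 by lia.
move: kL; move: (E ^ 2) (L./2) => e k; clear; nia.
Qed.

Lemma block_exists r : 0 < r -> exists Q L0, 0 < Q /\ forall L, L0 <= L ->
  exists w : 'I_(44 * r * L) -> nat, (forall i, 2 ^ L <= w i) /\
  forall W : {set 'I_(44 * r * L)}, 44 * L <= #|W| ->
  forall m, 8 * Q * L * 2 ^ L <= m < 40 * Q * L * 2 ^ L ->
    exists2 U : {set 'I_(44 * r * L)}, U \subset W & \sum_(i in U) w i = m.
Proof.
(* In [R ^ L = 4 ^ (44 * r * L) * 4 ^ (r * L)] the first factor pays for the pairs of index sets in
   the union bound, the second for the targets [y]. *)
move=> r0; pose R := 4 ^ (45 * r); pose Q := (2 * R)`!.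
pose E := 6 * Q * (18 * Q * R + 6) * R.
have R0 : 0 < R by rewrite expn_gt0.
have Q0 : 0 < Q by apply: fact_gt0.
have E0 : 0 < E by rewrite !muln_gt0 Q0 R0 addn_gt0 orbT.
have QR g : 0 < g < 2 * R -> g %| Q by case/andP => g0 gR; apply: dvdn_fact; rewrite g0 ltnW.
have [L1 H1] := linear_lt_exp_ratio (16 * R * Q) E0.
have [L2 H2] := linear_lt_exp_ratio (10 * Q) (ltn0Sn 0).
exists Q, (L1 + L2 + 2 * R); split=> // L LL.
have L0 : 0 < L by move: R0 LL; clear; lia.
pose M := 2 ^ L.
have RM : 2 * R <= M by apply: leq_trans (ltnW (ltn_expl L (isT : 1 < 2))); lia.
have EL : E ^ L * (2 * R * (2 * (4 * L + 3) * Q + 1)) < E.+1 ^ L.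
  apply: leq_ltn_trans (H1 L _); last by lia.
  by rewrite leq_mul2l; apply/orP; right; move: Q0; clear; nia.
pose N := 2 * Q * M; pose Z := ((4 * L + 3) * N).+1.
have M0 : 0 < M by rewrite expn_gt0.
have [x xgood] : exists x : {ffun 'I_(44 * r * L) -> 'I_M},
   forall (T U : {set 'I_(44 * r * L)}) y, [disjoint T & U] -> L <= #|U| ->
    exists2 i, i \in U & x i \notin avoid R E (sums Z (fun i => val_of M Q (x i)) T) y.
  pose F (T : {set 'I_(44 * r * L)}) (x : {ffun 'I_(44 * r * L) -> 'I_M}) :=
    @avoid M Q R E L (sums Z (fun i => val_of M Q (x i)) T).
  apply: (@exists_rarely_hit _ _ _ F R L) => [|T y i x z iT|T x y|].
  - by rewrite card_ord.
  - congr (avoid _ _ _ _); apply: eq_sums => j jT; rewrite ffunE.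
    by case: eqP => // ji; rewrite -ji jT in iT.
  - rewrite card_ord; apply: avoid_card => //; exact: sums_gt0.
  rewrite card_option !card_ord Zp_cast; last exact: (Z_gt1 L R0 Q0 RM).
  have -> : R ^ L = 4 ^ (44 * r * L) * 4 ^ (r * L).
    by rewrite -expnM -expnD; congr (_ ^ _); lia.
  rewrite ltn_pmul2l ?expn_gt0 //.
  apply: (@leq_trans (4 ^ L)); last by rewrite leq_exp2l //; nia.
  have := H2 L (leq_trans (leq_addl _ _) (leq_trans (leq_addr _ _) LL)).
  rewrite exp1n mul1n -[4]/(2 * 2) expnMn -/M /Z /N; move: Q0 M0 L0; clear; nia.
exists (fun i => val_of M Q (x i)); split.
  by move=> i; have /andP [h _] := v_bounds Q0 (x i); apply: leq_trans h; rewrite leq_pmull.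
move=> W WL m mb.
have [W3 W3W W3L] : exists2 W3 : {set 'I_(44 * r * L)}, W3 \subset W & #|W3| = 4 * L.
  exists [set i in take (4 * L) (enum W)].
    by apply/subsetP => i; rewrite inE => /mem_take; rewrite mem_enum.
  rewrite cardsE; have /card_uniqP -> := take_uniq (4 * L) (enum_uniq (mem W)).
  by rewrite size_takel // -cardE; apply: leq_trans WL; rewrite leq_mul2r orbT.
have [tau tauN H] := interval_sums R0 Q0 L0 RM QR (erefl E) (leqnn M) EL xgood W3L.
have dV : [disjoint W3 & W :\: W3].
  by rewrite disjoint_sym disjoints_subset; apply/subsetP => i; rewrite !inE => /andP [].
have V40 : 40 * L <= #|W :\: W3|.
  by have := cardsID W3 W; rewrite (setIidPr W3W); lia.
have SV : 40 * L * (Q * M) <= \sum_(i in W :\: W3) val_of M Q (x i).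
  apply: (@leq_trans (\sum_(i in W :\: W3) Q * M)).
    by rewrite sum_nat_const leq_mul2r V40 orbT.
  by apply: leq_sum => i _; have /andP [] := v_bounds Q0 (x i).
have H' m' : tau + N <= m' < tau + N + 2 * N -> exists2 U : {set 'I_(44 * r * L)},
    U \subset W3 & \sum_(i in U) val_of M Q (x i) = m'.
  by move=> m'b; apply: H; rewrite -/N; move: m'b; clear; lia.
(* The interval starts at [tau + N <= 4 * L * N = 8 * Q * L * M], and the terms outside [W3]
   lengthen it by at least [40 * Q * L * M]. *)
have mb' : tau + N <= m < tau + N + 2 * N + \sum_(i in W :\: W3) val_of M Q (x i).
  move: mb SV tauN; rewrite -/M -/N; move: (\sum_(i in _) _) => s; rewrite /N.
  move: (M) L0 Q0; clear; nia.
have [U UW Um] := extend_sums Q0 dV (leq_pmull N (isT : 0 < 2)) H' mb'.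
exists U => //; apply: subset_trans UW _; rewrite subUset W3W /=; exact: subsetDl.
Qed.

Lemma popular_colour r n (f : 'I_n -> 'I_r) k : r * k <= n -> 0 < r ->
  exists c, k <= #|[set i | f i == c]|.
Proof.
move=> rk r0; case: (boolP [exists c, k <= #|[set i | f i == c]|]) => [/existsP //|].
move/existsPn => H; exfalso; move: rk; rewrite leqNgt => /negP; apply.
have -> : n = \sum_(c < r) #|[set i | f i == c]|.
  rewrite -[LHS]card_ord -sum1_card (partition_big f predT) //=.
  by apply: eq_bigr => c _; rewrite sum1dep_card.
rewrite -[X in _ < X * _]card_ord -sum_nat_const.
have c0 : 'I_r by exact: (Ordinal r0).
rewrite (bigD1 c0) //= [X in _ < X](bigD1 c0) //= -addSn leq_add //.
  by rewrite ltnNge H.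
by apply: leq_sum => c _; rewrite ltnW // ltnNge H.
Qed.

(** * Blocks restated with lists of natural numbers *)

Lemma pow_expn m n : Nat.pow m n = m ^ n.
Proof. by elim: n => //= n ->; rewrite expnS. Qed.

Lemma In_mem (s : seq nat) k : List.In k s -> k \in s.
Proof.
elim: s => //= a s IH [->|/IH ks]; first by rewrite mem_head.
by rewrite inE ks orbT.
Qed.

Lemma uniq_NoDup (s : seq nat) : uniq s -> List.NoDup s.
Proof.
elim: s => [_|a s IH /= /andP [/negP as_ us]]; first exact: List.NoDup_nil.
by apply: List.NoDup_cons; [move/In_mem | exact: IH].
Qed.

Lemma block_lists r : (0 < r)%coq_nat -> exists Q L0, (0 < Q)%coq_nat /\
  forall L, (L0 <= L)%coq_nat ->
  exists w : nat -> nat, (forall k, (Nat.pow 2 L <= w k)%coq_nat) /\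
  forall col : nat -> nat, (forall k, (col k < r)%coq_nat) ->
  forall m, (8 * Q * L * Nat.pow 2 L <= m)%coq_nat ->
    (m < 40 * Q * L * Nat.pow 2 L)%coq_nat ->
    exists c s, [/\ (c < r)%coq_nat, List.NoDup s,
      List.Forall (fun k => (k < 44 * r * L)%coq_nat /\ col k = c) s
      & List.fold_right (fun k acc => (w k + acc)%coq_nat) 0 s = m].
Proof.
move=> /ltP r0; have [Q [L0 [Q0 H]]] := block_exists r0.
exists Q, L0; split; first exact/ltP.
move=> L /leP LL; have [w [wl wH]] := H L LL.
(* The default [2 ^ L] keeps the lower bound valid outside the block. *)
exists (fun k => if insub k is Some i then w i else 2 ^ L); split.
  by move=> k; apply/leP; rewrite pow_expn; case: insubP => [i _ _|_]; rewrite ?wl.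
move=> col colr m /leP m1 /ltP m2; rewrite pow_expn in m1 m2.
have colr' k : col k < r by apply/ltP.
have [|c cW] := @popular_colour r _ (fun i : 'I_(44 * r * L) => Ordinal (colr' i)) (44 * L) _ r0.
  by rewrite mulnA (mulnC r).
have [|U /subsetP UW Um] := wH _ cW m; first by rewrite m1.
exists c, (map val (enum U)); split.
- exact/ltP.
- apply: uniq_NoDup; rewrite map_inj_uniq ?enum_uniq //; exact: val_inj.
- apply/List.Forall_forall => k /In_mem /mapP [i]; rewrite mem_enum => iU ->.
  split; first by apply/ltP; apply: ltn_ord.
  by move: (UW i iU); rewrite inE => /eqP <-.
rewrite -Um -big_enum /=; elim: (enum U) => [|i s IH]; first by rewrite big_nil.
by rewrite big_cons /= IH valK plusE.
Qed.

End Blocks.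

(** * The sparse Ramsey complete sequence *)

Lemma NoDup_lt_length (s : list nat) (n : nat) :
  NoDup s -> (forall k, In k s -> (k < n)%nat) -> (length s <= n)%nat.
Proof.
intros nd H. rewrite <- (length_seq n 0). apply NoDup_incl_length; auto.
intros k hk. apply in_seq. specialize (H k hk). lia.
Qed.

Lemma between_consecutive (f : nat -> nat) (s0 m : nat) :
  (forall s, (s < f s)%nat) -> (f s0 <= m)%nat ->
  exists s, (s0 <= s)%nat /\ (f s <= m < f (S s))%nat.
Proof.
intros hf h0.
assert (K : forall d, (exists s, (s0 <= s)%nat /\ (f s <= m < f (S s))%nat)
            \/ (f (s0 + d) <= m)%nat).
{ induction d as [|d [IH|IH]].
  - right. now rewrite Nat.add_0_r.
  - now left.
  - destruct (le_lt_dec (f (S (s0 + d))) m) as [h|h].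
    + right. now rewrite Nat.add_succ_r.
    + left. exists (s0 + d)%nat. lia. }
destruct (K m) as [h|h]; auto.
specialize (hf (s0 + m)%nat). lia.
Qed.

Lemma INR_le_ln (l n : nat) : (2 ^ l <= n)%nat -> INR l <= 2 * ln (INR n).
Proof.
intros h.
assert (p : 0 < INR (2 ^ l)) by (apply lt_0_INR, Nat.neq_0_lt_0, Nat.pow_nonzero; lia).
assert (q : ln (INR (2 ^ l)) <= ln (INR n)).
{ apply le_INR in h. destruct (Rle_lt_or_eq_dec _ _ h) as [h'|h'].
  - left. now apply ln_increasing.
  - rewrite h'. lra. }
rewrite pow_INR, ln_pow in q by (simpl; lra).
replace (INR 2) with 2 in q by (simpl; lra).
pose proof ln_lt_2. pose proof (pos_INR l). nra.
Qed.

Lemma sparse_ramsey_complete :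
  exists C : R, forall r : nat, (2 <= r)%nat ->
    exists a : nat -> nat, (forall k, (0 < a k)%nat) /\ ramsey_complete r a /\
      (forall n : nat, (1 <= n)%nat -> count_le a n (C * INR r * (ln (INR n)) ^ 2)).
Proof.
(* Up to [n] there are at most [44 * r * l ^ 2] terms, with [l = Nat.log2 n <= 2 * ln n], and
   [176 = 44 * 4]. *)
exists 176. intros r hr.
destruct (@Blocks.block_lists r) as [Q [L0 [Q0 HL]]]; [lia|].
assert (CH : exists wf : nat -> nat -> nat, forall L, (L0 <= L)%nat ->
  (forall k, (2 ^ L <= wf L k)%nat) /\
  forall col : nat -> nat, (forall k, (col k < r)%nat) ->
  forall m, (8 * Q * L * 2 ^ L <= m)%nat -> (m < 40 * Q * L * 2 ^ L)%nat ->
    exists c s, (c < r)%nat /\ NoDup s /\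
      Forall (fun k => (k < 44 * r * L)%nat /\ col k = c) s /\
      fold_right (fun k acc => (wf L k + acc)%nat) 0%nat s = m).
{ apply (choice (fun L w => (L0 <= L)%nat ->
    (forall k, (2 ^ L <= w k)%nat) /\
    forall col : nat -> nat, (forall k, (col k < r)%nat) ->
    forall m, (8 * Q * L * 2 ^ L <= m)%nat -> (m < 40 * Q * L * 2 ^ L)%nat ->
      exists c s, (c < r)%nat /\ NoDup s /\
        Forall (fun k => (k < 44 * r * L)%nat /\ col k = c) s /\
        fold_right (fun k acc => (w k + acc)%nat) 0%nat s = m)).
  intros L. destruct (le_lt_dec L0 L) as [h|h].
  - destruct (HL L h) as [w [w1 w2]]. exists w. intros _. split; [exact w1|].
    intros col hc m m1 m2. destruct (w2 col hc m m1 m2) as [c [s [s1 s2 s3 s4]]].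
    exists c, s. auto.
  - exists (fun _ => 0%nat). lia. }
destruct CH as [wf Hwf].
set (B := (44 * r)%nat). set (s0 := (L0 + 8)%nat).
assert (s0E : s0 = (L0 + 8)%nat) by reflexivity. clearbody s0.
assert (BE : B = (44 * r)%nat) by reflexivity. clearbody B.
assert (B0 : (B <> 0)%nat) by lia.
(* Only odd [L = 2 * s + 1] are used. Block [s] then has [B * (s + 1) ^ 2 - B * s ^ 2] terms and
   starts at index [B * s ^ 2 - B * s0 ^ 2], so a square root recovers the block from the index. *)
set (lev := fun k => Nat.sqrt ((k + B * s0 ^ 2) / B)).
set (a := fun k => wf (2 * lev k + 1)%nat (k + B * s0 ^ 2 - B * lev k ^ 2)%nat).
assert (lev_spec : forall k, (B * lev k ^ 2 <= k + B * s0 ^ 2 < B * S (lev k) ^ 2)%nat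
                             /\ (s0 <= lev k)%nat).
{ intros k. unfold lev. set (j := ((k + B * s0 ^ 2) / B)%nat).
  pose proof (Nat.sqrt_spec j ltac:(lia)) as [h1 h2].
  pose proof (Nat.div_mod (k + B * s0 ^ 2) B B0) as h3.
  pose proof (Nat.mod_upper_bound (k + B * s0 ^ 2) B B0) as h4.
  fold j in h3. set (q := ((k + B * s0 ^ 2) mod B)%nat) in *. rewrite h3, !Nat.pow_2_r. split.
  - pose proof (Nat.mul_le_mono_l _ _ B h1). pose proof (Nat.mul_le_mono_l _ _ B h2). lia.
  - apply Nat.sqrt_le_square. unfold j. apply Nat.div_le_lower_bound; auto.
    rewrite Nat.pow_2_r. lia. }
assert (sq : forall s t, (s <= t)%nat -> (B * s ^ 2 <= B * t ^ 2)%nat).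
{ intros s t h. apply Nat.mul_le_mono_l, Nat.pow_le_mono_l, h. }
assert (lev_eq : forall s i, (s0 <= s)%nat -> (i < B * (2 * s + 1))%nat ->
  lev (B * s ^ 2 + i - B * s0 ^ 2)%nat = s).
{ intros s i hs hi.
  set (k := (B * s ^ 2 + i - B * s0 ^ 2)%nat).
  pose proof (sq _ _ hs).
  assert (hk : (k + B * s0 ^ 2 = B * s ^ 2 + i)%nat) by (unfold k; lia).
  destruct (lev_spec k) as [[h1 h2] h3]. rewrite hk in h1, h2.
  assert (sS : (B * S s ^ 2 = B * s ^ 2 + B * (2 * s + 1))%nat)
    by (rewrite !Nat.pow_2_r; ring).
  destruct (Nat.lt_trichotomy (lev k) s) as [h|[h|h]]; auto;
    apply sq in h; exfalso; lia. }
assert (a_large : forall k, (2 ^ (2 * lev k + 1) <= a k)%nat).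
{ intros k. destruct (lev_spec k) as [_ h]. unfold a. apply Hwf. lia. }
exists a. split; [|split].
- intros k. specialize (a_large k).
  assert (0 < 2 ^ (2 * lev k + 1))%nat by (apply Nat.neq_0_lt_0, Nat.pow_nonzero; lia). lia.
- intros col hcol.
  set (lo := fun s => (8 * Q * (2 * s + 1) * 2 ^ (2 * s + 1))%nat).
  exists (lo s0). intros m hm.
  destruct (between_consecutive lo s0 m) as [s [hs [h1 h2]]]; auto.
  { intros s. unfold lo. assert (0 < 2 ^ (2 * s + 1))%nat
      by (apply Nat.neq_0_lt_0, Nat.pow_nonzero; lia). nia. }
  destruct (Hwf (2 * s + 1)%nat) as [_ H]; [lia|].
  destruct (H (fun i => col (B * s ^ 2 + i - B * s0 ^ 2)%nat) (fun i => hcol _) m)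
    as [c [u [u1 [u2 [u3 u4]]]]]; auto.
  (* With [L = 2 * s + 1], the intervals for [L] and [L + 2] leave no gap when
     [32 * (L + 2) <= 40 * L], which holds since [s >= s0 >= 8]. *)
  { unfold lo in h2. replace (2 * S s + 1)%nat with (S (S (2 * s + 1))) in h2 by lia.
    rewrite !Nat.pow_succ_r' in h2. set (P := (2 ^ (2 * s + 1))%nat) in *.
    assert (8 <= s)%nat by lia.
    eapply Nat.lt_le_trans; [exact h2|]. nia. }
  exists c. split; auto.
  pose proof (sq _ _ hs) as sq0.
  exists (map (fun i => (B * s ^ 2 + i - B * s0 ^ 2)%nat) u). split; [|split].
  + apply FinFun.Injective_map_NoDup; auto. intros i i' hi. lia.
  + apply Forall_map. eapply Forall_impl; [|exact u3]. intros i [_ hi]. exact hi.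
  + rewrite <- u4. clear u4 u2. induction u as [|i u IH]; auto.
    apply Forall_cons_iff in u3 as [[hi _] hu].
    change (sum_terms a (map (fun i => (B * s ^ 2 + i - B * s0 ^ 2)%nat) (i :: u)))
      with (a (B * s ^ 2 + i - B * s0 ^ 2)%nat
        + sum_terms a (map (fun i => (B * s ^ 2 + i - B * s0 ^ 2)%nat) u))%nat.
    simpl fold_right. rewrite (IH hu). f_equal. unfold a.
    rewrite lev_eq by (auto; rewrite BE; lia). f_equal. lia.
- intros n hn t nd ht.
  set (l := Nat.log2 n).
  assert (hl : (2 ^ l <= n < 2 ^ S l)%nat) by (apply Nat.log2_spec; lia).
  assert (len : (length t <= B * l ^ 2)%nat).
  { apply NoDup_lt_length; auto. intros k hk.
    rewrite Forall_forall in ht. specialize (ht k hk).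
    assert (h : (2 * lev k + 1 < S l)%nat).
    { apply (Nat.pow_lt_mono_r_iff 2); [lia|]. specialize (a_large k). lia. }
    destruct (lev_spec k) as [[_ h2] h3].
    pose proof (sq (S (lev k)) l ltac:(lia)). lia. }
  apply le_INR in len. eapply Rle_trans; [exact len|].
  rewrite mult_INR, pow_INR. rewrite BE, mult_INR.
  pose proof (INR_le_ln l n (proj1 hl)) as h. pose proof (pos_INR l) as h0.
  pose proof (pos_INR r) as h1.
  replace (INR 44) with 44 by (simpl; lra).
  assert (INR l ^ 2 <= 4 * ln (INR n) ^ 2) by (simpl; nra).
  nra.
Qed.

(** * Sparser sequences are not Ramsey complete *)

Definition wsum (w : nat -> R) (s : list nat) : R := fold_right (fun k acc => w k + acc) 0 s.

Lemma wsum_app w s t : wsum w (s ++ t) = wsum w s + wsum w t.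
Proof. induction s as [|k s IH]; simpl; [|rewrite IH]; ring. Qed.

Lemma wsum_le w w' s : (forall k, In k s -> w k <= w' k) -> wsum w s <= wsum w' s.
Proof.
induction s as [|k s IH]; simpl; intros H; [lra|].
apply Rplus_le_compat; auto.
Qed.

Lemma wsum_lt w w' s :
  s <> nil -> (forall k, In k s -> w k < w' k) -> wsum w s < wsum w' s.
Proof.
destruct s as [|k s]; [tauto|]. intros _ H. simpl. apply Rplus_lt_le_compat.
- apply H. now left.
- apply wsum_le. intros j hj. left. apply H. now right.
Qed.

Lemma exp_le_compat x y : x <= y -> exp x <= exp y.
Proof. intros [h| ->]; [left; now apply exp_increasing|lra]. Qed.

Lemma wsum_minus w w' s : wsum (fun k => w k - w' k) s = wsum w s - wsum w' s.
Proof. induction s as [|k s IH]; simpl; [|rewrite IH]; ring. Qed.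

Lemma wsum_scal x w s : wsum (fun k => x * w k) s = x * wsum w s.
Proof. induction s as [|k s IH]; simpl; [|rewrite IH]; ring. Qed.

Lemma wsum_filter_le w s P : (forall k, 0 <= w k) -> wsum w (filter P s) <= wsum w s.
Proof.
intros H. induction s as [|k s IH]; simpl; [lra|].
specialize (H k). destruct (P k); simpl; lra.
Qed.

Lemma wsum_const x s : wsum (fun _ => x) s = INR (length s) * x.
Proof.
induction s as [|k s IH]; [simpl; ring|].
change (x + wsum (fun _ => x) s = INR (S (length s)) * x). rewrite S_INR, IH. ring.
Qed.

Lemma wsum_INR a s : wsum (fun k => INR (a k)) s = INR (sum_terms a s).
Proof.
induction s as [|k s IH]; auto.
change (INR (a k) + wsum (fun k => INR (a k)) s = INR (a k + sum_terms a s)).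
now rewrite plus_INR, IH.
Qed.

(** * Balanced distribution over classes *)

Lemma wsum_delta v y j k :
  wsum (fun c => if y =? c then v else 0) (seq j k)
  = if andb (j <=? y) (y <? j + k) then v else 0.
Proof.
revert j. induction k as [|k IH]; intros j; simpl.
- destruct (Nat.leb_spec j y); destruct (Nat.ltb_spec y (j + 0)); simpl; auto; lia.
- rewrite IH.
  destruct (Nat.eqb_spec y j); destruct (Nat.leb_spec j y); destruct (Nat.leb_spec (S j) y);
    destruct (Nat.ltb_spec y (S j + k)); destruct (Nat.ltb_spec y (j + S k)); simpl;
    try lia; lra.
Qed.

Lemma wsum_plus w w' s : wsum (fun k => w k + w' k) s = wsum w s + wsum w' s.
Proof. induction s as [|k s IH]; simpl; [|rewrite IH]; ring. Qed.

Lemma wsum_classes w (f : nat -> nat) k s : (forall x, (f x < k)%nat) ->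
  wsum (fun c => wsum w (filter (fun x => f x =? c) s)) (seq 0 k) = wsum w s.
Proof.
intros hf. induction s as [|x s IH].
- simpl. rewrite wsum_const. ring.
- transitivity (wsum (fun c => (if f x =? c then w x else 0)
      + wsum w (filter (fun x => f x =? c) s)) (seq 0 k)).
  + apply Rle_antisym; apply wsum_le; intros c _; simpl; destruct (f x =? c); simpl; lra.
  + rewrite wsum_plus, wsum_delta, IH. simpl.
    specialize (hf x). apply Nat.ltb_lt in hf. now rewrite hf.
Qed.

(* Greedy: the next item goes to a class whose load is at most the average. *)
Lemma balanced_classes w (k : nat) s : (0 < k)%nat -> NoDup s ->
  (forall x, 0 <= w x <= 1) ->
  exists f : nat -> nat, (forall x, (f x < k)%nat) /\
    forall c, wsum w (filter (fun x => f x =? c) s) <= wsum w s / INR k + 1.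
Proof.
intros k0 nd hw.
assert (kp : 0 < INR k) by now apply lt_0_INR.
induction s as [|x s IH].
- exists (fun _ => 0%nat). split; auto. intros c. simpl. unfold Rdiv. lra.
- apply NoDup_cons_iff in nd as [xs nd]. destruct (IH nd) as [f [f1 f2]].
  assert (ex : exists c, (c < k)%nat /\
    wsum w (filter (fun x => f x =? c) s) <= wsum w s / INR k).
  { apply NNPP. intros H.
    assert (K : wsum w s < wsum w s).
    { rewrite <- (wsum_classes w f k s f1) at 2.
      replace (wsum w s) with (wsum (fun _ => wsum w s / INR k) (seq 0 k)).
      - apply wsum_lt; [now destruct k|]. intros c hc. apply in_seq in hc.
        apply Rnot_le_lt. intros hle. apply H. exists c. split; [lia|exact hle].
      - rewrite wsum_const, length_seq. field. lra. }
    lra. }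
  destruct ex as [c0 [c1 c2]].
  exists (fun y => if y =? x then c0 else f y). split.
  { intros y. destruct (y =? x); auto. }
  intros c.
  assert (E : filter (fun y => (if y =? x then c0 else f y) =? c) s
            = filter (fun y => f y =? c) s).
  { apply filter_ext_in. intros y hy. destruct (Nat.eqb_spec y x); auto. now subst. }
  simpl. rewrite Nat.eqb_refl, E.
  pose proof (hw x) as hx.
  assert (wsum w s / INR k <= (w x + wsum w s) / INR k).
  { unfold Rdiv. apply Rmult_le_compat_r; [left; now apply Rinv_0_lt_compat|lra]. }
  destruct (Nat.eqb_spec c0 c) as [->|_]; simpl.
  + lra.
  + specialize (f2 c). lra.
Qed.

(** * Subset sums of lists *)

Lemma sum_terms_perm a s t : Permutation s t -> sum_terms a s = sum_terms a t.
Proof. unfold sum_terms. induction 1; simpl; lia. Qed.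

Lemma sum_terms_ge a s k : In k s -> (a k <= sum_terms a s)%nat.
Proof.
unfold sum_terms. induction s as [|x s IH]; simpl; [tauto|].
intros [->|h]; [|specialize (IH h)]; lia.
Qed.

Lemma sum_terms_filter a P s :
  sum_terms a s
  = (sum_terms a (filter P s) + sum_terms a (filter (fun k => negb (P k)) s))%nat.
Proof.
unfold sum_terms. induction s as [|x s IH]; simpl; auto. destruct (P x); simpl; lia.
Qed.

Lemma sum_terms_incl a s t : NoDup s -> incl s t -> (sum_terms a s <= sum_terms a t)%nat.
Proof.
revert s. induction t as [|x t IH]; intros s nd h.
- apply incl_l_nil in h. subst. auto.
- destruct (in_dec Nat.eq_dec x s) as [xs|xs].
  + apply in_split in xs as [s1 [s2 ->]].
    rewrite (sum_terms_perm a (s1 ++ x :: s2) (x :: s1 ++ s2)) by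
      (symmetry; apply Permutation_middle).
    apply NoDup_remove in nd as [nd1 nd2].
    assert (sum_terms a (s1 ++ s2) <= sum_terms a t)%nat.
    { apply IH; auto. intros y hy. destruct (h y) as [->|]; auto; [|tauto].
      apply in_app_iff in hy. apply in_app_iff. simpl. tauto. }
    simpl. unfold sum_terms in *. lia.
  + assert (sum_terms a s <= sum_terms a t)%nat.
    { apply IH; auto. intros y hy. destruct (h y hy) as [->|]; tauto. }
    simpl. unfold sum_terms in *. lia.
Qed.

(** Sums are listed with multiplicity, so that their generating function factorises. *)
Fixpoint subset_sums (l : list nat) : list nat :=
  match l with
  | nil => 0%nat :: nil
  | b :: l => subset_sums l ++ map (Nat.add b) (subset_sums l)
  end.

Lemma sum_terms_subset_sums a s t :
  NoDup s -> incl s t -> In (sum_terms a s) (subset_sums (map a t)).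
Proof.
revert s. induction t as [|x t IH]; intros s nd h.
- apply incl_l_nil in h. subst. simpl. auto.
- simpl. apply in_app_iff. destruct (in_dec Nat.eq_dec x s) as [xs|xs].
  + right. apply in_split in xs as [s1 [s2 ->]].
    rewrite (sum_terms_perm a (s1 ++ x :: s2) (x :: s1 ++ s2)) by
      (symmetry; apply Permutation_middle).
    apply NoDup_remove in nd as [nd1 nd2].
    apply in_map_iff. exists (sum_terms a (s1 ++ s2)). split; auto.
    apply IH; auto. intros y hy. destruct (h y) as [->|]; auto; [|tauto].
    apply in_app_iff in hy. apply in_app_iff. simpl. tauto.
  + left. apply IH; auto. intros y hy. destruct (h y hy) as [->|]; tauto.
Qed.

(** The left side is the product of the factors [1 + exp (- (b / y))], and [1 + x <= exp x]. *)
Lemma wsum_exp_subset_sums y l :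
  wsum (fun n => exp (- (INR n / y))) (subset_sums l)
  <= exp (wsum (fun b => exp (- (INR b / y))) l).
Proof.
induction l as [|b l IH].
- simpl. unfold Rdiv. rewrite Rmult_0_l, Ropp_0, exp_0. lra.
- simpl. rewrite wsum_app.
  assert (E : wsum (fun n => exp (- (INR n / y))) (map (Nat.add b) (subset_sums l))
    = exp (- (INR b / y)) * wsum (fun n => exp (- (INR n / y))) (subset_sums l)).
  { generalize (subset_sums l). intros u. induction u as [|n u IHu]; [simpl; ring|].
    change (exp (- (INR (b + n) / y)) + wsum (fun n => exp (- (INR n / y))) (map (Nat.add b) u)
     = exp (- (INR b / y)) * (exp (- (INR n / y)) + wsum (fun n => exp (- (INR n / y))) u)).
    rewrite IHu, plus_INR.
    replace (- ((INR b + INR n) / y)) with (- (INR b / y) + - (INR n / y)) by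
      (unfold Rdiv; ring).
    rewrite exp_plus. ring. }
  rewrite E, exp_plus.
  pose proof (exp_ineq1_le (exp (- (INR b / y)))).
  pose proof (exp_pos (- (INR b / y))).
  pose proof (exp_pos (wsum (fun b => exp (- (INR b / y))) l)).
  assert (0 <= wsum (fun n => exp (- (INR n / y))) (subset_sums l)).
  { rewrite <- (Rmult_0_r (INR (length (subset_sums l)))), <- wsum_const.
    apply wsum_le. intros; left; apply exp_pos. }
  nra.
Qed.

(* Exponential Markov inequality for the number of subsets with small sum. *)
Lemma few_small_subset_sums y l m : 0 < y ->
  INR (length (filter (fun n => n <=? m) (subset_sums l)))
  <= exp (INR m / y + wsum (fun b => exp (- (INR b / y))) l).
Proof.
intros y0. rewrite exp_plus.
eapply Rle_trans; [|apply Rmult_le_compat_l; [left; apply exp_pos|apply wsum_exp_subset_sums]].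
generalize (subset_sums l). intros u. rewrite <- wsum_scal.
rewrite <- (Rmult_1_r (INR (length _))), <- wsum_const.
eapply Rle_trans; [|apply (wsum_filter_le _ u (fun n => n <=? m)%nat)].
- apply wsum_le. intros k hk. apply filter_In in hk as [_ hk]. apply Nat.leb_le in hk.
  rewrite <- exp_plus. rewrite <- exp_0 at 1. apply exp_le_compat.
  apply le_INR in hk. unfold Rdiv. rewrite <- Ropp_mult_distr_l_reverse, <- Rmult_plus_distr_r.
  apply Rmult_le_pos; [lra|left; now apply Rinv_0_lt_compat].
- intros k. left. apply Rmult_lt_0_compat; apply exp_pos.
Qed.

(** * Terms below a bound and light scales *)

Lemma enumerate_below a n B : count_le a n B ->
  exists s, NoDup s /\ forall k, In k s <-> (a k <= n)%nat.
Proof.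
intros H.
assert (hK : exists K, forall s, NoDup s -> Forall (fun k => (a k <= n)%nat) s ->
                     (length s <= K)%nat).
{ destruct (INR_unbounded B) as [K hK]. exists K. intros s s1 s2.
  specialize (H s s1 s2). apply INR_le. lra. }
destruct hK as [K hK].
assert (ind : forall d s, NoDup s -> Forall (fun k => (a k <= n)%nat) s ->
  (K <= length s + d)%nat -> exists s, NoDup s /\ forall k, In k s <-> (a k <= n)%nat).
{ induction d as [|d IH]; intros s s1 s2 s3;
    destruct (classic (exists k, ~ In k s /\ (a k <= n)%nat)) as [[k [k1 k2]]|no].
  - assert (length (k :: s) <= K)%nat by (apply hK; constructor; auto). simpl in *. lia.
  - exists s. split; auto. intros k. rewrite Forall_forall in s2. split; auto.
    intros hk. apply NNPP. intros hn. apply no. now exists k.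
  - apply (IH (k :: s)); [constructor; auto|constructor; auto|simpl; lia].
  - exists s. split; auto. intros k. rewrite Forall_forall in s2. split; auto.
    intros hk. apply NNPP. intros hn. apply no. now exists k. }
apply (ind K nil); auto using NoDup_nil.
Qed.

(** A smooth step from [0] to [1] as [2 ^ l] passes [a k]. Up to a factor [6], its increment from
    [l] to [l + 1] dominates the load [a k / 2 ^ l] of a small term and the weight
    [exp (- (a k / 2 ^ l))] of a large one, so a telescoping sum controls both. *)
Definition ratio (a : nat -> nat) (l k : nat) : R := 2 ^ l / (2 ^ l + INR (a k)).

Lemma ratio_bounds a l k : 0 <= ratio a l k <= 1.
Proof.
unfold ratio. pose proof (pow_lt 2 l ltac:(lra)). pose proof (pos_INR (a k)).
split.
- apply Rmult_le_pos; [lra|left; apply Rinv_0_lt_compat; lra].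
- apply Rmult_le_reg_r with (2 ^ l + INR (a k)); [lra|]. field_simplify; lra.
Qed.

Lemma ratio_step a l k :
  ratio a (S l) k - ratio a l k
  = 2 ^ l * INR (a k) / ((2 * 2 ^ l + INR (a k)) * (2 ^ l + INR (a k))).
Proof.
unfold ratio. pose proof (pow_lt 2 l ltac:(lra)). pose proof (pos_INR (a k)).
simpl. field. split; lra.
Qed.

Lemma ratio_step_ge0 a l k : 0 <= ratio a (S l) k - ratio a l k.
Proof.
rewrite ratio_step. pose proof (pow_lt 2 l ltac:(lra)). pose proof (pos_INR (a k)).
apply Rmult_le_pos; [nra|]. left. apply Rinv_0_lt_compat. nra.
Qed.

Lemma ratio_step_small a l k : INR (a k) <= 2 ^ l ->
  INR (a k) / 2 ^ l <= 6 * (ratio a (S l) k - ratio a l k).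
Proof.
intros h. rewrite ratio_step. pose proof (pow_lt 2 l ltac:(lra)). pose proof (pos_INR (a k)).
set (t := 2 ^ l) in *. set (u := INR (a k)) in *.
replace (u / t) with (6 * (t * u / (6 * (t * t)))) by (field; lra).
apply Rmult_le_compat_l; [lra|]. apply Rmult_le_compat_l; [nra|].
apply Rinv_le_contravar; nra.
Qed.

Lemma ratio_step_large a l k : 2 ^ l < INR (a k) ->
  exp (- (INR (a k) / 2 ^ l)) <= 6 * (ratio a (S l) k - ratio a l k).
Proof.
intros h. rewrite ratio_step. pose proof (pow_lt 2 l ltac:(lra)).
set (t := 2 ^ l) in *. set (u := INR (a k)) in *.
apply Rle_trans with (t / u).
- rewrite exp_Ropp. replace (t / u) with (/ (u / t)) by (field; lra).
  apply Rinv_le_contravar.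
  + apply Rdiv_lt_0_compat; lra.
  + pose proof (exp_ineq1_le (u / t)). lra.
- replace (t / u) with (6 * (t * u / (6 * (u * u)))) by (field; lra).
  apply Rmult_le_compat_l; [lra|]. apply Rmult_le_compat_l; [nra|].
  apply Rinv_le_contravar; nra.
Qed.

(* The increments of [ratio] telescope, so some scale carries at most the average. *)
Lemma light_scale a n s : (0 < n)%nat ->
  exists l, (n <= l < 2 * n)%nat /\
    wsum (fun k => ratio a (S l) k - ratio a l k) s <= INR (length s) / INR n.
Proof.
intros n0. assert (np : 0 < INR n) by now apply lt_0_INR.
apply NNPP. intros H.
(* If every scale exceeded the average, the [n] increments would total more than [length s],
   although [ratio] stays in [[0, 1]]. *)
assert (up : forall j, (j < n)%nat -> wsum (ratio a n) s
   + INR (S j) * (INR (length s) / INR n) < wsum (ratio a (n + S j)) s).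
{ assert (st : forall l, (n <= l < 2 * n)%nat ->
    INR (length s) / INR n < wsum (ratio a (S l)) s - wsum (ratio a l) s).
  { intros l hl. rewrite <- wsum_minus. apply Rnot_le_lt. intros hle. apply H.
    exists l. split; auto. }
  induction j as [|j IH]; intros hj.
  - specialize (st n ltac:(lia)). rewrite Nat.add_1_r. simpl INR. lra.
  - specialize (IH ltac:(lia)). specialize (st (n + S j)%nat ltac:(lia)).
    rewrite <- Nat.add_succ_r in st. rewrite (S_INR (S j)). lra. }
destruct n as [|n]; [lia|]. specialize (up n ltac:(lia)).
replace (INR (S n) * (INR (length s) / INR (S n))) with (INR (length s)) in up by
  (field; lra).
assert (0 <= wsum (ratio a (S n)) s).
{ rewrite <- (Rmult_0_r (INR (length s))), <- wsum_const.
  apply wsum_le. intros k _. apply ratio_bounds. }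
assert (wsum (ratio a (S n + S n)) s <= INR (length s)).
{ rewrite <- (Rmult_1_r (INR (length s))), <- wsum_const.
  apply wsum_le. intros k _. apply ratio_bounds. }
lra.
Qed.

(** * Colouring so that one more integer is missed *)

Lemma length_flat_map_le {A B} (f : A -> list B) l x :
  (forall y, In y l -> INR (length (f y)) <= x) ->
  INR (length (flat_map f l)) <= INR (length l) * x.
Proof.
induction l as [|y l IH]; intros H; [simpl; lra|].
change (flat_map f (y :: l)) with (f y ++ flat_map f l).
change (length (y :: l)) with (S (length l)).
rewrite length_app, plus_INR, S_INR.
pose proof (H y (or_introl eq_refl)).
assert (INR (length (flat_map f l)) <= INR (length l) * x)
  by (apply IH; intros; apply H; now right).
lra.
Qed.

Lemma missing_in_range (s : list nat) p : (length s < p)%nat ->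
  exists m, (p < m <= 2 * p)%nat /\ ~ In m s.
Proof.
intros h. apply NNPP. intros H.
assert (length (seq (S p) p) <= length s)%nat.
{ apply NoDup_incl_length; [apply seq_NoDup|]. intros m hm. apply in_seq in hm.
  apply NNPP. intros hn. apply H. exists m. split; auto; lia. }
rewrite length_seq in *. lia.
Qed.

Lemma exp_half_le_pow2 l : exp (INR l / 2) <= 2 ^ l.
Proof.
assert (h : exp (1 / 2) <= 2).
{ assert (exp (1 / 2) * exp (1 / 2) <= 3).
  { rewrite <- exp_plus. replace (1 / 2 + 1 / 2) with 1 by field. apply exp_le_3. }
  pose proof (exp_pos (1 / 2)). nra. }
induction l as [|l IH].
- simpl. unfold Rdiv. rewrite Rmult_0_l, exp_0. lra.
- rewrite S_INR. replace ((INR l + 1) / 2) with (1 / 2 + INR l / 2) by field.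
  rewrite exp_plus. simpl. pose proof (exp_pos (1 / 2)). pose proof (exp_pos (INR l / 2)).
  nra.
Qed.

Lemma ln_pow2_le n : 0 <= ln (INR (2 ^ n)) <= INR n.
Proof.
rewrite pow_INR, ln_pow by (simpl; lra). replace (INR 2) with 2 by (simpl; lra).
pose proof (pos_INR n). pose proof ln_lt_2.
assert (ln 2 <= 1).
{ pose proof (exp_ineq1_le (ln 2)). rewrite exp_ln in *; lra. }
split; nra.
Qed.

(* Terms up to 2^l are spread over the first half of the colours, so that the total
   of each class stays below m; larger terms are spread over the second half, so that
   each class has too few subset sums up to m to reach every candidate m. *)
Lemma avoid_one_more a r N0 col0 b0 : (2 <= r)%nat ->
  (forall n, (N0 <= n)%nat -> count_le a n (/ 1620 * INR r * ln (INR n) ^ 2)) ->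
  (forall k, (col0 k < r)%nat) ->
  exists col m, (forall k, (col k < r)%nat) /\ (b0 < m)%nat /\
    (forall k, (a k <= b0)%nat -> col k = col0 k) /\
    forall i, ~ in_Sigma_class a col i m.
Proof.
intros hr hcnt hcol0.
destruct (enumerate_below a (N0 + b0) _ (hcnt _ (Nat.le_add_r _ _))) as [sb [_ hsb]].
(* [T0] bounds what the terms with already fixed colours can contribute to any sum. *)
set (T0 := sum_terms a sb). set (k0 := (r / 2)%nat).
assert (hk0 : (1 <= k0 /\ 2 * k0 <= r /\ r <= 3 * k0)%nat).
{ unfold k0. pose proof (Nat.div_mod r 2 ltac:(lia)).
  pose proof (Nat.mod_upper_bound r 2 ltac:(lia)). lia. }
(* The [120] ensures [l / 8 - 1 >= l / 10 + 2]; the last summand lets the exponential gain absorb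
   the factor [k0 * (T0 + 1)]. *)
set (n := (120 + N0 + b0 + T0 + 20 * k0 * (T0 + 1))%nat).
assert (hn : (120 <= n /\ N0 <= n /\ b0 <= n /\ T0 <= n /\ 20 * k0 * (T0 + 1) <= n)%nat)
  by (unfold n; lia).
clearbody n.
assert (pw : forall j, (j < 2 ^ j)%nat) by (intros; apply Nat.pow_gt_lin_r; lia).
assert (hA : (N0 <= 2 ^ (3 * n))%nat) by (pose proof (pw (3 * n)%nat); lia).
pose proof (hcnt _ hA) as cnt.
destruct (enumerate_below a _ _ cnt) as [s [nds hs]].
(* In [1620 = 9 * 180] the [9] comes from [ln (2 ^ (3 * n)) <= 3 * n], and [180 = 6 * 3 * 10]
   combines the factor [6] for [ratio], [r <= 3 * k0] and the target [l / 10]. *)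
assert (lens : INR (length s) <= / 180 * INR r * INR n ^ 2).
{ eapply Rle_trans; [apply cnt; auto|].
  - apply Forall_forall. intros k hk. now apply hs.
  - pose proof (ln_pow2_le (3 * n)) as [q1 q2]. pose proof (pos_INR r).
    rewrite mult_INR in q2. replace (INR 3) with 3 in q2 by (simpl; lra).
    pose proof (pos_INR n).
    pose proof (pow_incr _ _ 2 (conj q1 q2)) as q3.
    replace ((3 * INR n) ^ 2) with (9 * INR n ^ 2) in q3 by ring.
    apply (Rmult_le_compat_l (INR r)) in q3; auto. lra. }
destruct (light_scale a n s ltac:(lia)) as [l [hl light]].
set (y := (2 ^ l)%nat).
assert (yR : INR y = 2 ^ l) by (unfold y; rewrite pow_INR; f_equal; simpl; lra).
assert (yp : 0 < INR y) by (rewrite yR; apply pow_lt; lra).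
assert (yl : (l < y)%nat) by apply pw.
assert (lR : 120 <= INR l) by (replace 120 with (INR 120) by (simpl; lra); apply le_INR; lia).
assert (light' : 6 * wsum (fun k => ratio a (S l) k - ratio a l k) s / INR k0 <= INR l / 10).
{ assert (nR : 0 < INR n) by (apply lt_0_INR; lia).
  assert (INR (length s) / INR n <= / 180 * INR r * INR n).
  { apply Rmult_le_reg_r with (INR n); auto. field_simplify; [|lra]. lra. }
  assert (INR r <= 3 * INR k0).
  { replace 3 with (INR 3) by (simpl; lra). rewrite <- mult_INR. apply le_INR. lia. }
  assert (INR n <= INR l) by (apply le_INR; lia).
  assert (kp : 0 < INR k0) by (apply lt_0_INR; lia).
  apply Rmult_le_reg_r with (INR k0); auto.
  replace (6 * wsum (fun k => ratio a (S l) k - ratio a l k) s / INR k0 * INR k0)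
    with (6 * wsum (fun k => ratio a (S l) k - ratio a l k) s) by (field; lra).
  assert (INR r * INR n <= 3 * INR k0 * INR l).
  { apply Rmult_le_compat; auto; try lra. apply pos_INR. }
  lra. }
set (sm := filter (fun k => a k <=? y) s).
set (bg := filter (fun k => negb (a k <=? y)) s).
set (wS := fun k => if a k <=? y then INR (a k) / INR y else 0).
set (wB := fun k => exp (- (INR (a k) / INR y))).
destruct (balanced_classes wS k0 sm ltac:(lia) (NoDup_filter _ nds)) as [f1 [f1k f1w]].
{ intros k. unfold wS. destruct (Nat.leb_spec (a k) y) as [h|h]; [|lra].
  apply le_INR in h. pose proof (pos_INR (a k)). split.
  - apply Rmult_le_pos; [lra|left; now apply Rinv_0_lt_compat].
  - apply Rmult_le_reg_r with (INR y); auto. field_simplify; lra. }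
destruct (balanced_classes wB k0 bg ltac:(lia) (NoDup_filter _ nds)) as [f2 [f2k f2w]].
{ intros k. unfold wB. split; [left; apply exp_pos|].
  rewrite <- exp_0. apply exp_le_compat. pose proof (pos_INR (a k)).
  assert (0 <= INR (a k) / INR y)
    by (apply Rmult_le_pos; [lra|left; now apply Rinv_0_lt_compat]). lra. }
assert (incr : forall w s', (forall k, In k s' -> w k <= 6 * (ratio a (S l) k - ratio a l k)) ->
  (exists P, s' = filter P s) -> wsum w s' / INR k0 + 1 <= INR l / 10 + 1).
{ intros w s' hw [P ->]. apply Rplus_le_compat_r. eapply Rle_trans; [|exact light'].
  apply Rmult_le_compat_r; [left; apply Rinv_0_lt_compat, lt_0_INR; lia|].
  rewrite <- wsum_scal. eapply Rle_trans; [apply wsum_le; exact hw|].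
  apply wsum_filter_le. intros k. pose proof (ratio_step_ge0 a l k). lra. }
assert (smw : forall c, wsum wS (filter (fun x => f1 x =? c) sm) <= INR l / 10 + 1).
{ intros c. eapply Rle_trans; [apply f1w|]. apply incr; [|eexists; reflexivity].
  intros k hk. apply filter_In in hk as [_ hk]. unfold wS. rewrite hk, yR.
  apply ratio_step_small. rewrite <- yR. apply le_INR. now apply Nat.leb_le. }
assert (bgw : forall c, wsum wB (filter (fun x => f2 x =? c) bg) <= INR l / 10 + 1).
{ intros c. eapply Rle_trans; [apply f2w|]. apply incr; [|eexists; reflexivity].
  intros k hk. apply filter_In in hk as [_ hk]. unfold wB. rewrite yR.
  apply ratio_step_large. rewrite <- yR. apply lt_INR.
  apply Bool.negb_true_iff, Nat.leb_gt in hk. exact hk. }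
clear f1w f2w incr.
(* The missed [m] is sought in [(p, 2 * p]]; as [2 * p <= 2 ^ (3 * n)], only terms of [s] can take
   part in a sum equal to [m]. *)
set (q := (l / 8)%nat). set (p := (y * q)%nat).
assert (hq : (8 * q <= l < 8 * q + 8)%nat).
{ unfold q. pose proof (Nat.div_mod l 8 ltac:(lia)).
  pose proof (Nat.mod_upper_bound l 8 ltac:(lia)). lia. }
assert (hqR : 8 * INR q <= INR l < 8 * INR q + 8).
{ replace 8 with (INR 8) by (simpl; lra). rewrite <- mult_INR, <- plus_INR.
  split; [apply le_INR|apply lt_INR]; lia. }
assert (hp : (2 * p <= 2 ^ (3 * n))%nat).
{ replace (3 * n)%nat with (2 * n + n)%nat by lia. rewrite Nat.pow_add_r.
  assert (y <= 2 ^ (2 * n))%nat by (apply Nat.pow_le_mono_r; lia).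
  assert (2 * q <= 2 ^ n)%nat by (pose proof (pw n); lia).
  unfold p. nia. }
set (Bc := fun c => filter (fun x => f2 x =? c) bg).
(* Each sum up to [2 * p] of a class of large terms is shifted by every conceivable contribution
   [0, ..., T0] of the fixed terms. *)
set (bad := flat_map (fun c => flat_map (fun x => map (Nat.add x) (seq 0 (S T0)))
  (filter (fun x => x <=? 2 * p) (subset_sums (map a (Bc c))))) (seq 0 k0)).
assert (lbad : (length bad < p)%nat).
{ apply INR_lt.
  apply Rle_lt_trans with (INR k0 * (exp (INR l / 4 + (INR l / 10 + 1)) * INR (T0 + 1))).
  - rewrite <- (length_seq k0 0) at 1. unfold bad. apply length_flat_map_le. intros c _.
    eapply Rle_trans; [apply (length_flat_map_le _ _ (INR (T0 + 1)))|].
    + intros x _. rewrite length_map, length_seq. apply le_INR. lia.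
    + apply Rmult_le_compat_r; [apply pos_INR|].
      eapply Rle_trans; [apply (few_small_subset_sums (INR y)); exact yp|].
      apply exp_le_compat. apply Rplus_le_compat.
      * unfold p. rewrite !mult_INR. replace (INR 2) with 2 by (simpl; lra).
        replace (2 * (INR y * INR q) / INR y) with (2 * INR q) by (field; lra). lra.
      * specialize (bgw c). fold (Bc c) in bgw.
        replace (wsum (fun b => exp (- (INR b / INR y))) (map a (Bc c)))
          with (wsum wB (Bc c)); auto.
        generalize (Bc c). intros u. induction u as [|k u IH]; simpl; auto. now rewrite IH.
  - apply Rlt_le_trans with (2 ^ l * 1).
    + apply Rlt_le_trans with (exp (INR l / 2)); [|rewrite Rmult_1_r; apply exp_half_le_pow2].
      replace (INR l / 2) with ((INR l / 4 + (INR l / 10 + 1)) + (3 * INR l / 20 - 1)) by field.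
      rewrite (exp_plus (INR l / 4 + (INR l / 10 + 1))).
      pose proof (exp_pos (INR l / 4 + (INR l / 10 + 1))) as ep.
      assert (K : INR k0 * INR (T0 + 1) < exp (3 * INR l / 20 - 1)).
      { pose proof (exp_ineq1_le (3 * INR l / 20 - 1)).
        assert (20 * (INR k0 * INR (T0 + 1)) <= INR l).
        { replace 20 with (INR 20) by (simpl; lra). rewrite <- !mult_INR. apply le_INR. lia. }
        lra. }
      nra.
    + unfold p. rewrite mult_INR, yR. apply Rmult_le_compat_l; [apply pow_le; lra|].
      lra. }
destruct (missing_in_range bad p lbad) as [m [hm nm]].
exists (fun k => if a k <=? b0 then col0 k else if a k <=? y then f1 k else (k0 + f2 k)%nat), m.
assert (yp' : (y <= p)%nat) by (unfold p; nia).
split; [|split; [|split]].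
- intros k. specialize (hcol0 k). specialize (f1k k). specialize (f2k k).
  destruct (a k <=? b0); [|destruct (a k <=? y)]; lia.
- lia.
- intros k hk. apply Nat.leb_le in hk. now rewrite hk.
- intros i [t [ndt [ht sumt]]]. rewrite Forall_forall in ht.
  assert (tin : forall k, In k t -> In k s).
  { intros k hk. apply hs. pose proof (sum_terms_ge a t k hk). lia. }
  rewrite (sum_terms_filter a (fun k => a k <=? b0)) in sumt.
  set (t0 := filter (fun k => a k <=? b0) t) in *.
  set (t1 := filter (fun k => negb (a k <=? b0)) t) in *.
  assert (ht0 : (sum_terms a t0 <= T0)%nat).
  { apply sum_terms_incl; [now apply NoDup_filter|]. intros k hk.
    apply filter_In in hk as [_ hk]. apply Nat.leb_le in hk. apply hsb. lia. }
  assert (ht1 : forall k, In k t1 -> In k s /\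
    (if a k <=? y then f1 k else (k0 + f2 k)%nat) = i).
  { intros k hk. apply filter_In in hk as [hk1 hk2]. split; auto.
    specialize (ht k hk1). apply Bool.negb_true_iff in hk2. now rewrite hk2 in ht. }
  destruct (le_lt_dec k0 i) as [hi|hi].
  + assert (inc : incl t1 (Bc (i - k0)%nat)).
    { intros k hk. destruct (ht1 k hk) as [k1 k2]. unfold Bc, bg. rewrite !filter_In.
      specialize (f1k k). destruct (a k <=? y); [lia|]. repeat split; auto.
      apply Nat.eqb_eq. lia. }
    destruct (le_lt_dec k0 (i - k0)) as [hi2|hi2].
    (* Colours from [2 * k0] on receive no term beyond [b0], so their sums are at most [T0]. *)
    * assert (t1 = nil).
      { apply incl_l_nil. intros k hk. apply inc in hk. apply filter_In in hk as [_ hk].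
        apply Nat.eqb_eq in hk. specialize (f2k k). lia. }
      rewrite H in sumt. simpl in sumt. lia.
    * apply nm. apply in_flat_map. exists (i - k0)%nat. split; [apply in_seq; lia|].
      apply in_flat_map. exists (sum_terms a t1). split.
      -- apply filter_In. split; [|apply Nat.leb_le; lia].
         apply sum_terms_subset_sums; auto. now apply NoDup_filter.
      -- apply in_map_iff. exists (sum_terms a t0). split; [lia|]. apply in_seq. lia.
  + assert (inc : incl t1 (filter (fun x => f1 x =? i) sm)).
    { intros k hk. destruct (ht1 k hk) as [k1 k2]. unfold sm. rewrite !filter_In.
      destruct (a k <=? y) eqn:e; [|lia]. repeat split; auto. now apply Nat.eqb_eq. }
    assert (le1 : (sum_terms a t1 <= sum_terms a (filter (fun x => f1 x =? i) sm))%nat).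
    { apply sum_terms_incl; auto. now apply NoDup_filter. }
    assert (eq1 : INR (sum_terms a (filter (fun x => f1 x =? i) sm))
      = INR y * wsum wS (filter (fun x => f1 x =? i) sm)).
    { rewrite <- wsum_INR, <- wsum_scal.
      assert (E : forall k, In k (filter (fun x => f1 x =? i) sm) -> INR (a k) = INR y * wS k).
      { intros k hk. apply filter_In in hk as [hk _]. apply filter_In in hk as [_ hk].
        unfold wS. rewrite hk. field. lra. }
      apply Rle_antisym; apply wsum_le; intros k hk; rewrite (E k hk); lra. }
    specialize (smw i).
    assert (INR m <= INR p); [|apply INR_le in H; lia].
    apply Rle_trans with (INR T0 + INR y * (INR l / 10 + 1)).
    * rewrite <- sumt, plus_INR. apply Rplus_le_compat; [now apply le_INR|].
      eapply Rle_trans; [apply le_INR, le1|]. rewrite eq1.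
      apply Rmult_le_compat_l; lra.
    * assert (INR T0 <= INR y) by (apply le_INR; lia).
      unfold p. rewrite mult_INR.
      assert (INR y * (INR l / 10 + 2) <= INR y * INR q) by (apply Rmult_le_compat_l; lra).
      lra.
Qed.

(** * Repeated recolouring and the limit colouring *)

Lemma sparse_not_ramsey_complete a r : (2 <= r)%nat ->
  (exists N : nat, forall n : nat, (N <= n)%nat ->
     count_le a n (/ 1620 * INR r * (ln (INR n)) ^ 2)) ->
  ~ ramsey_complete r a.
Proof.
intros hr [N0 hcnt] hram.
(* A state is a colouring with a bound. The next state keeps the colours of terms up to the bound,
   and its own bound is a newly missed integer. *)
set (next := fun x y : (nat -> nat) * nat => (forall k, (fst x k < r)%nat) ->
  (forall k, (fst y k < r)%nat) /\ (snd x < snd y)%nat /\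
  (forall k, (a k <= snd x)%nat -> fst y k = fst x k) /\
  forall i, ~ in_Sigma_class a (fst y) i (snd y)).
destruct (choice next) as [F hF].
{ intros [col b]. destruct (classic (forall k, (col k < r)%nat)) as [h|h].
  - destruct (avoid_one_more a r N0 col b hr hcnt h) as [col' [m H]].
    exists (col', m). intros _. exact H.
  - exists (col, b). intros h'. tauto. }
set (st := fix st j := match j with O => (fun _ : nat => 0%nat, 0%nat) | S j => F (st j) end).
assert (valid : forall j k, (fst (st j) k < r)%nat).
{ induction j as [|j IH]; [simpl; lia|]. apply (hF (st j)). exact IH. }
assert (step : forall j, (snd (st j) < snd (st (S j)))%nat /\
  (forall k, (a k <= snd (st j))%nat -> fst (st (S j)) k = fst (st j) k) /\
  forall i, ~ in_Sigma_class a (fst (st (S j))) i (snd (st (S j)))).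
{ intros j. apply (hF (st j)), valid. }
assert (big : forall j, (j <= snd (st j))%nat).
{ induction j as [|j IH]; [lia|]. destruct (step j) as [h _]. lia. }
assert (agree : forall d j k, (a k <= snd (st j))%nat -> fst (st (d + j)%nat) k = fst (st j) k).
{ induction d as [|d IH]; intros j k hk; auto.
  rewrite <- (IH j k hk). apply (step (d + j)%nat).
  clear IH. induction d as [|d IHd]; auto. destruct (step (d + j)%nat) as [h _]. simpl in *. lia. }
(* By stage [a k] the bound has reached [a k], so the colour of [k] no longer changes. *)
set (col := fun k => fst (st (a k)) k).
assert (hcol : forall j k, (a k <= snd (st j))%nat -> col k = fst (st j) k).
{ intros j k hk. unfold col. destruct (le_lt_dec j (a k)) as [h|h].
  - replace (a k) with (a k - j + j)%nat at 1 by lia. now apply agree.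
  - replace j with (j - a k + a k)%nat by lia. symmetry. apply agree, big. }
destruct (hram col) as [N hN]; [intros k; apply valid|].
destruct (hN (snd (st (S N)))) as [i [_ [t [t1 [t2 t3]]]]].
{ specialize (big (S N)). lia. }
(* A sum equal to the missed integer uses only terms up to it, and their colours are already final
   at that stage. *)
destruct (step N) as [_ [_ no]]. apply (no i). exists t. split; [|split]; auto.
rewrite Forall_forall in *. intros k hk. rewrite <- (t2 k hk). symmetry. apply hcol.
rewrite <- t3. now apply sum_terms_ge.
Qed.

Theorem theorem1p1 :
  (exists C : R,
     forall r : nat, (2 <= r)%nat ->
       exists a : nat -> nat,
         (forall k, (0 < a k)%nat) /\
         ramsey_complete r a /\
         (forall n : nat, (1 <= n)%nat ->
            count_le a n (C * INR r * (ln (INR n)) ^ 2)))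
  /\
  (exists c : R, 0 < c /\
     forall r : nat, (2 <= r)%nat ->
       forall a : nat -> nat,
         (forall k, (0 < a k)%nat) ->
         (exists N : nat, forall n : nat, (N <= n)%nat ->
            count_le a n (c * INR r * (ln (INR n)) ^ 2)) ->
         ~ ramsey_complete r a).
Proof.
split; [exact sparse_ramsey_complete|].
exists (/ 1620). split; [lra|].
intros r hr a _ hcnt. now apply sparse_not_ramsey_complete.
Qed.
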